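(* Let $n\geq 2$ and let $k\geq d$ be two positive integers. Let $W^\flat$ be a hypersurface of degree $2k$ in $\mathbf{P}^n$ with an ordinary double singularity along $Z$, a smooth complete intersection of type $(k,k-d)$ in $\mathbf{P}^n$ (with the convention that $Z=\emptyset$ if $k=d$). Assume moreover that $W^\flat$ is general among such hypersurfaces. Then there exists a family, of dimension at least $h^0(\mathbf{P}^n,\mathcal{O}_{\mathbf{P}^n}(2d-k))$, of hypersurfaces $B$ of degree $2d$ everywhere tangent to $W^\flat$ and such that there exists a unique hypersurface of degree $k$ containing $Z$ and cutting out on $B$ the contact locus of $B$ and $W^\flat$.
   Context: Work over $\mathbf{C}$. A complete intersection of type $(k,k-d)$ is the complete intersection of two hypersurfaces of degrees $k$ and $k-d$. ''$B$ is everywhere tangent to $W^\flat$, and the degree $k$ hypersurface $A$ cuts out the contact locus of $B$ and $W^\flat$ on $B$'' means that the scheme-theoretic intersection of $W^\flat$ with $B$ is, as a divisor on $B$, twice the divisor cut out on $B$ by $A$. *)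

(* Defs.v *)
From mathcomp Require Import all_boot all_order all_algebra.
From mathcomp Require Import reals.
From mathcomp Require Import complex.
From mathcomp Require Import mpoly.

Set Implicit Arguments.
Unset Strict Implicit.
Unset Printing Implicit Defensive.

Import GRing.Theory.
Local Open Scope ring_scope.

(* Projective space P^n over K has homogeneous coordinate ring
   {mpoly K[n.+1]}; its points are the nonzero z : 'I_n.+1 -> K, up to scalars.
   A hypersurface (possibly non-reduced) is given by its equation, a nonzero
   form, which is determined up to a nonzero scalar: see [same_hypersurface].
   For D = 0 this is the empty hypersurface. *)
Definition is_point (K : fieldType) (n : nat) (z : 'I_n.+1 -> K) : Prop :=
  exists i, z i != 0.

Definition hypersurface (K : fieldType) (n D : nat)
    (F : {mpoly K[n.+1]}) : Prop :=
  F != 0 /\ F \is D.-homog.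

Definition same_hypersurface (K : fieldType) (n : nat)
    (F G : {mpoly K[n.+1]}) : Prop :=
  exists2 c : K, c != 0 & G = c *: F.

(* Closed subschemes of P^n are given by a finite list of equations.  They are
   compared through their ideal sheaves, that is, locally at every point: two
   lists may define the same subscheme and generate different ideals. *)
Definition in_ideal (K : fieldType) (n : nat)
    (gs : seq {mpoly K[n.+1]}) (f : {mpoly K[n.+1]}) : Prop :=
  exists u : nat -> {mpoly K[n.+1]}, f = \sum_(i < size gs) u i * gs`_i.

Definition in_stalk (K : fieldType) (n : nat)
    (gs : seq {mpoly K[n.+1]}) (z : 'I_n.+1 -> K)
    (f : {mpoly K[n.+1]}) : Prop :=
  exists2 s : {mpoly K[n.+1]}, s.@[z] != 0 & in_ideal gs (s * f).

(* V(gs) is a closed subscheme of V(hs) *)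
Definition subscheme (K : fieldType) (n : nat)
    (gs hs : seq {mpoly K[n.+1]}) : Prop :=
  forall z, is_point z -> {in hs, forall h, in_stalk gs z h}.

Definition same_scheme (K : fieldType) (n : nat)
    (gs hs : seq {mpoly K[n.+1]}) : Prop :=
  subscheme gs hs /\ subscheme hs gs.

(* Z = V(P, Q) is a smooth complete intersection of type (k, e), by the Jacobian
   criterion.  If e = 0 then Q is a nonzero constant and Z is empty. *)
Definition smooth_complete_intersection (K : fieldType) (n k e : nat)
    (P Q : {mpoly K[n.+1]}) : Prop :=
  [/\ hypersurface k P, hypersurface e Q &
      forall z, is_point z -> P.@[z] = 0 -> Q.@[z] = 0 ->
        row_free (col_mx (\row_i (P^`M(i)).@[z]) (\row_i (Q^`M(i)).@[z]))].

(* The equation F lies in the square of the ideal sheaf of Z = V(P, Q) *)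
Definition double_along (K : fieldType) (n : nat)
    (P Q F : {mpoly K[n.+1]}) : Prop :=
  subscheme [:: P ^+ 2; P * Q; Q ^+ 2] [:: F].

(* The class of F in I^2/I^3 (x) k(z) = Sym^2(I/I^2 (x) k(z)), I being the ideal
   of Z = V(P, Q), is a nondegenerate quadratic form: in the basis P, Q of I/I^2
   it is a P^2 + b P Q + c Q^2 up to the unit s. *)
Definition ordinary_double_at (K : fieldType) (n : nat)
    (P Q F : {mpoly K[n.+1]}) (z : 'I_n.+1 -> K) : Prop :=
  exists s a b c : {mpoly K[n.+1]},
    [/\ s.@[z] != 0,
        s * F = a * P ^+ 2 + b * (P * Q) + c * Q ^+ 2 &
        (b.@[z]) ^+ 2 - 4%:R * a.@[z] * c.@[z] != 0].

(* F is double along Z, and the transverse singularity is an ordinary double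
   point on a Zariski-dense subset of Z.  It cannot be so at every point of Z
   when dim Z > 0: the discriminant is a form of positive degree on Z. *)
Definition ordinary_double_along (K : fieldType) (n : nat)
    (P Q F : {mpoly K[n.+1]}) : Prop :=
  double_along P Q F /\
  forall H : {mpoly K[n.+1]},
    (forall z, is_point z -> P.@[z] = 0 -> Q.@[z] = 0 ->
       ordinary_double_at P Q F z -> H.@[z] = 0) ->
    forall z, is_point z -> P.@[z] = 0 -> Q.@[z] = 0 -> H.@[z] = 0.

(* The effective Cartier divisors cut out on the hypersurface B by F and G are
   well defined (F and G are nonzerodivisors modulo B) and equal. *)
Definition cuts_divisor (K : fieldType) (n : nat)
    (B F : {mpoly K[n.+1]}) : Prop :=
  forall G, in_ideal [:: B] (F * G) -> in_ideal [:: B] G.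

Definition same_divisor_on (K : fieldType) (n : nat)
    (B F G : {mpoly K[n.+1]}) : Prop :=
  [/\ cuts_divisor B F, cuts_divisor B G & same_scheme [:: F; B] [:: G; B]].

(* B is everywhere tangent to F = 0, and A = 0 cuts out their contact locus on
   B: the divisor cut out on B by F is twice the one cut out by A. *)
Definition cuts_contact_locus (K : fieldType) (n : nat)
    (F B A : {mpoly K[n.+1]}) : Prop :=
  same_divisor_on B F (A ^+ 2).

(* Coordinates on the vector space of forms of degree D; those indexed by
   monomials of degree < D vanish. *)
Definition ncoef (n D : nat) : nat := #|{: 'X_{1..n.+1 < D.+1}}|.

Definition coefs (K : fieldType) (n D : nat) (F : {mpoly K[n.+1]}) :
    'I_(ncoef n D) -> K :=
  fun i => F@_(enum_val i : 'X_{1..n.+1 < D.+1}).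

Arguments coefs {K n} D F.

(* C holds for the general member of the set X of forms of degree D: it holds on
   a dense open subset, the locus in X where the equations S do not all vanish.
   The sets X used are stable under nonzero scalars, so that it does not matter
   whether one works with forms or in the projective space of hypersurfaces. *)
Definition for_general (K : fieldType) (n D : nat)
    (X C : {mpoly K[n.+1]} -> Prop) : Prop :=
  exists S : seq {mpoly K[ncoef n D]},
    let U F := X F /\ exists2 f, f \in S & f.@[coefs D F] != 0 in
    (forall g : {mpoly K[ncoef n D]},
       (forall F, U F -> g.@[coefs D F] = 0) ->
       forall F, X F -> g.@[coefs D F] = 0) /\
    (forall F, U F -> C F).

(* The Zariski closure of a set Y of forms of degree D has dimension at least r:
   r polynomial functions are algebraically independent on Y. *)
Definition dim_geq (K : fieldType) (n D : nat)
    (Y : {mpoly K[n.+1]} -> Prop) (r : nat) : Prop :=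
  exists f : 'I_r -> {mpoly K[ncoef n D]},
    forall g : {mpoly K[r]},
      (forall F, Y F -> g.@[fun j => (f j).@[coefs D F]] = 0) -> g = 0.

(* There is a family, of dimension at least N, of hypersurfaces of degree D
   satisfying C.  The parameter space is a locally closed subset T of an affine
   space, B_t depends polynomially on t, and the dimension is that of the set of
   the B_t in the projective space of hypersurfaces, hence one less than that of
   the cone over it. *)
Definition exists_family (K : fieldType) (n D N : nat)
    (C : {mpoly K[n.+1]} -> Prop) : Prop :=
  exists (m : nat) (E O : seq {mpoly K[m]}) (B : {mpoly {mpoly K[m]}[n.+1]}),
    let T t := {in E, forall e, e.@[t] = 0} /\ exists2 o, o \in O & o.@[t] != 0 in
    let member t := map_mpoly (meval t) B in
    (forall t, T t -> hypersurface D (member t) /\ C (member t)) /\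
    dim_geq D (fun G => exists2 t, T t & same_hypersurface (member t) G) N.+1.

(* h^0(P^n, O(e)) *)
Definition h0 (K : fieldType) (n : nat) (e : int) : nat :=
  match e with
  | Posz j => \dim {: dhomog n.+1 K j}
  | Negz _ => 0
  end.

(* Main.v *)
(** An equation of degree [2k] lying in the square of the saturated ideal [(P, Q)] has the form
    [W = a P^2 + b P Q + c Q^2], with [a] constant and [b], [c] forms of degrees [d], [2d].
    Completing the square, [4 a W = A0^2 + Q^2 B0] with [A0 = 2 a P + b Q] and
    [B0 = 4 a c - b^2], and for every form [m] of degree [2d - k]
      [4 a W = (A0 + Q^2 m)^2 + Q^2 (B0 - 2 A0 m - Q^2 m^2)],
    so that [B_m = B0 - 2 A0 m - Q^2 m^2] is tangent to [W] along [A_m = A0 + Q^2 m].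

    Another form [A'] of degree [k] through [Z] with the same contact divisor satisfies
    [A'^2 = r^2 A_m^2] modulo [B_m] for a constant [r], so it is a multiple of [A_m] as soon as
    no product of two nonzero forms of degree [k] of the ideal [(P, Q)] is a multiple of [B_m].
    This is an open condition on [(A_m, B_m)].  It holds for [(P, B)] with [B] prime and
    nowhere zero on a suitable finite subset of [Z], and such a [B] is found in a pencil of
    forms [h^(2d) + t x^(2d-1) y]; hence it holds for general [W] and general [m].

    Conditions on stalks at all points turn into ideal membership by the Nullstellensatz, which
    is elementary over an uncountable algebraically closed field, together with the saturation
    of [(P, Q)] and [(P, Q)^2], where [n >= 2] enters. *)
From HB Require Import structures.
Require Import Defs.
From mathcomp Require Import all_boot all_order all_algebra.
From mathcomp Require Import reals.
From mathcomp Require Import complex.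
From mathcomp Require Import mpoly.
From mathcomp Require Import boolp.
From mathcomp Require classical_sets.
From mathcomp Require Import ring lra zify.

Set Implicit Arguments.
Unset Strict Implicit.
Unset Printing Implicit Defensive.

Import Order.TTheory GRing.Theory Num.Theory.
Local Open Scope ring_scope.

(** * The Nullstellensatz over an uncountable field *)

(** The family comes from an ambiguity in the expression of W: for a form m of degree 2d - k,
    replacing (b, c) by (b + m Q, c - m P) leaves W unchanged, and completing the square with the
    new pair turns (A0, B0) into (A_m, B_m). Uniqueness must hold for general W and general m, while
    it can only be checked by hand on one pair. It is therefore deduced from a condition that
    amounts to the full rank of a matrix at every nonzero vector, so that elimination theory makes
    it open. Dimension theory and primary decomposition are avoided: that something is not a zero
    divisor is read on lines parallel to a vector p at which the top form of some F does not vanish.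
    Along them F is a polynomial in T with invertible leading coefficient, K[X][T]/(F) is free over
    K[X], and one line without common zeros suffices. The same device yields a finite set of points
    such that every c vanishing at none of them is regular modulo (P, Q). *)

Definition uncountable (T : Type) := forall e : nat -> T, exists x, forall i, e i <> x.

Definition is_ideal (A : comPzRingType) (I : A -> Prop) :=
  [/\ I 0, forall f g, I f -> I g -> I (f + g) & forall f g, I g -> I (f * g)].

(** If every fiber had bounded size it would be listed by some [L e], and decoding natural numbers
    as pairs (e, j) would enumerate [T]. *)
Lemma infinite_fiber (T : choiceType) (x0 : T) (c : T -> nat) : uncountable T ->
  exists e, forall M, exists s : seq T,
    [/\ uniq s, size s = M & {in s, forall x, c x = e}].
Proof.
move=> uT; apply: contrapT => /forallNP noe.
have /choice [L hL] : forall e, exists l : seq T, forall x, c x = e -> x \in l.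
  move=> e; have /existsNP[M] := noe e.
  elim: M => [[]|M IH nM]; first by exists [::].
  have [[s [us ss cs]]|/IH//] := pselect (exists s : seq T,
    [/\ uniq s, size s = M & {in s, forall x, c x = e}]).
  exists s => x cx; apply: contrapT => /negP xs; apply: nM.
  exists (x :: s); split; rewrite /= ?xs ?ss //.
  by move=> y; rewrite inE => /predU1P[->//|/cs].
have [x hx] := uT (fun i => if unpickle i is Some (e, j) then nth x0 (L e) j else x0).
apply: (hx (pickle (c x, index x (L (c x))))).
by rewrite pickleK nth_index // hL.
Qed.

Lemma mpoly_lin_dep (K : fieldType) (n M e : nat) (g : 'I_M -> {mpoly K[n]}) :
  (#|{: 'X_{1..n < e}}| < M)%N -> (forall j, msize (g j) <= e)%N ->
  exists2 c : 'I_M -> K, (exists j, c j != 0) & \sum_j c j *: g j = 0.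
Proof.
move=> ltM hg.
pose G : 'M[K]_(M, #|{: 'X_{1..n < e}}|) := \matrix_(j, m) (g j)@_(enum_val m : 'X_{1..n < e}).
have : kermx G != 0.
  rewrite kermx_eq0 /row_free; apply/eqP => E.
  by have := rank_leq_col G; rewrite E leqNgt ltM.
case/rowV0Pn => v /sub_kermxP vG /rV0Pn [j vj].
exists (fun j => v 0 j); first by exists j.
apply/mpolyP => m; rewrite mcoeff0 raddf_sum /=.
have [lm|lm] := leqP e (mdeg m).
  rewrite big1 // => i _; rewrite mcoeffZ memN_msupp_eq0 ?mulr0 //.
  by apply: msize_mdeg_ge; apply: leq_trans lm.
move/rowP: vG => /(_ (enum_rank (BMultinom lm))); rewrite !mxE => vG.
rewrite -[RHS]vG; apply: eq_bigr => i _.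
by rewrite mxE enum_rankK mcoeffZ.
Qed.

Lemma mpoly_ring_ind (R : nzRingType) (n : nat) (P : {mpoly R[n]} -> Prop) :
  (forall c, P c%:MP) -> (forall i, P 'X_i) ->
  (forall f g, P f -> P g -> P (f + g)) -> (forall f g, P f -> P g -> P (f * g)) ->
  forall f, P f.
Proof.
move=> PC PX PD PM; elim/mpolyind => [|c m f _ _ IH]; first by rewrite -mpolyC0; apply: PC.
apply: PD => //; rewrite -mul_mpolyC; apply: (PM _ _ (PC c)); rewrite mpolyXE_id.
elim/big_ind: _ => [|//|i _]; first by rewrite -mpolyC1; apply: PC.
elim: (m i) => [|k IHk]; first by rewrite expr0 -mpolyC1; apply: PC.
by rewrite exprS; apply: (PM).
Qed.

Lemma idealB (A : comPzRingType) (I : A -> Prop) f g :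
  is_ideal I -> I f -> I g -> I (f - g).
Proof. by move=> [I0 ID IM] If Ig; apply: ID => //; rewrite -mulN1r; exact: IM. Qed.

Lemma ideal_sum (A : comPzRingType) (I : A -> Prop) (J : Type) (r : seq J) (P : pred J) F :
  is_ideal I -> (forall j, P j -> I (F j)) -> I (\sum_(j <- r | P j) F j).
Proof. by move=> [I0 ID IM] hF; elim/big_ind: _. Qed.

Section Null.
Context (K : closedFieldType) (n : nat).
Implicit Types (I : {mpoly K[n]} -> Prop).
Hypothesis uK : uncountable K.

Definition adjoin_ideal I (g : {mpoly K[n]}) f := exists a b, I a /\ f = a + b * g.

Lemma adjoin_idealP I g : is_ideal I ->
  [/\ is_ideal (adjoin_ideal I g), forall f, I f -> adjoin_ideal I g f
    & adjoin_ideal I g g].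
Proof.
move=> [I0 ID IM]; split; first split.
- by exists 0, 0; rewrite mul0r addr0.
- move=> f h [a [b [Ia ->]]] [c [e [Ic ->]]]; exists (a + c), (b + e).
  by split; [exact: ID|rewrite mulrDl addrACA].
- move=> f h [a [b [Ia ->]]]; exists (f * a), (f * b).
  by split; [exact: IM|rewrite mulrDr mulrA].
- by move=> f If; exists f, 0; rewrite mul0r addr0.
- by exists 0, 1; rewrite mul1r add0r.
Qed.

(* Otherwise every z gives a relation w ^+ m = b_z * ('X_i - z) modulo I; uncountably many of
   them share m and a degree bound for b_z, and a linear dependence between these b_z,
   multiplied by the product of the 'X_i - z, yields a relation p('X_i) * w ^+ m = 0 modulo I
   with p != 0, although p('X_i) divides a power of w modulo I. *)
Lemma adjoin_coordinate I (w : {mpoly K[n]}) i : is_ideal I -> (forall m, ~ I (w ^+ m)) ->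
  exists z, forall m, ~ adjoin_ideal I ('X_i - z%:MP) (w ^+ m).
Proof.
move=> Iid Iw; have [I0 ID IM] := Iid.
apply: contrapT => /forallNP nz.
have /choice [mb hmb] : forall z, exists mb : nat * {mpoly K[n]},
    I (w ^+ mb.1 - mb.2 * ('X_i - z%:MP)).
  move=> z; have /existsNP[m /contrapT [a [b [Ia E]]]] := nz z.
  by exists (m, b); rewrite /= E addrK.
pose ev (p : {poly K}) : {mpoly K[n]} := (map_poly (@mpolyC n K) p).['X_i].
have evE : {morph ev : p q / p * q} by move=> p q; rewrite /ev rmorphM hornerM.
pose S p := exists q m, I (w ^+ m - q * ev p).
have S1 z : S ('X - z%:P).
  exists (mb z).2, (mb z).1.
  by rewrite /ev rmorphB /= map_polyX map_polyC !hornerE; apply: hmb.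
have SM p q : S p -> S q -> S (p * q).
  move=> [a [m Ha]] [b [m' Hb]]; exists (a * b), (m + m')%N.
  rewrite evE exprD.
  have -> : w ^+ m * w ^+ m' - a * b * (ev p * ev q) =
    w ^+ m' * (w ^+ m - a * ev p) + (a * ev p) * (w ^+ m' - b * ev q).
    by rewrite !mulrBr [w ^+ m' * w ^+ m]mulrC addrA [w ^+ m' * _]mulrC subrK mulrACA.
  by apply: ID; apply: IM.
have SC c : c != 0 -> S c%:P.
  move=> c0; exists (c^-1)%:MP, 0%N.
  by rewrite /ev map_polyC hornerC -mpolyCM mulVf // subrr.
(* [S] is multiplicative and contains the nonzero constants and the X - z; these generate all
   nonzero polynomials, [K] being algebraically closed. *)
have Sall p : p != 0 -> S p.
  move=> p0; have [r ->] := closed_field_poly_normal p.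
  rewrite -mul_polyC; apply: (SM _ _); first by apply: (SC _); rewrite lead_coef_eq0.
  elim: r => [|x r IH]; first by rewrite big_nil; apply: SC; rewrite oner_eq0.
  by rewrite big_cons; apply: SM.
have [e he] := infinite_fiber 0 (fun z => pickle ((mb z).1, msize (mb z).2)) uK.
have [z0 [_ sz0 ce0]] := he 1%N.
case: z0 sz0 ce0 => [//|z0 [|//]] _ /(_ z0 (mem_head _ _)) ce.
set m0 := (mb z0).1 in ce; set e0 := msize (mb z0).2 in ce.
have [s [us ss cs]] := he (#|{: 'X_{1..n < e0}}|.+1).
set M := size s in ss.
have hs (j : 'I_M) : mb s`_j = (m0, (mb s`_j).2) /\ msize (mb s`_j).2 = e0.
  have := cs _ (mem_nth 0 (ltn_ord j)); rewrite -ce => /(pcan_inj pickleK).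
  by case: (mb _) => a b /= [-> ->].
have [] := @mpoly_lin_dep K n M e0 (fun j => (mb s`_j).2).
- by rewrite ss.
- by move=> j; have [_ ->] := hs j.
move=> c [j0 cj0] csum.
(* The numerator of the sum of the c_j / (X - s_j). At the node of index [j0] only the term [j0]
   survives, so it is nonzero. *)
pose p := \sum_j c j *: \prod_(l | l != j) ('X - (s`_l)%:P) : {poly K}.
have p0 : p != 0.
  apply/eqP => /(congr1 (horner^~ s`_j0)); rewrite /p horner0 horner_sum (bigD1 j0) //=.
  rewrite [X in _ + X]big1 => [|j jj0].
    rewrite addr0 hornerZ horner_prod => /eqP; rewrite mulf_eq0 (negPf cj0) /=.
    apply/negP; rewrite prodf_seq_neq0; apply/allP => l _; apply/implyP => lj.
    rewrite !hornerE subr_eq0 nth_uniq ?ltn_ord // eq_sym.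
    exact: lj.
  rewrite hornerZ horner_prod (bigD1 j0) 1?eq_sym //= hornerXsubC.
  by rewrite subrr mul0r mulr0.
have [q [m1 hq]] := Sall p p0.
have evp : I (w ^+ m0 * ev p).
  have -> : w ^+ m0 * ev p = \sum_j (c j)%:MP *
      (ev (\prod_(l | l != j) ('X - (s`_l)%:P)) * (w ^+ m0 - (mb s`_j).2 * ev ('X - (s`_j)%:P))).
    transitivity (\sum_j (c j)%:MP * (w ^+ m0 * ev (\prod_(l | l != j) ('X - (s`_l)%:P))) -
       (\sum_j c j *: (mb s`_j).2) * ev (\prod_(l < M) ('X - (s`_l)%:P))).
      rewrite csum mul0r subr0 /p /ev rmorph_sum horner_sum mulr_sumr.
      apply: eq_bigr => j _; rewrite -mul_polyC rmorphM /= map_polyC hornerM hornerC.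
      by rewrite mulrCA.
    rewrite mulr_suml -sumrB; apply: eq_bigr => j _.
    rewrite mulrBr mulrBr [_ * w ^+ m0]mulrC; congr (_ - _).
    rewrite [in LHS](bigD1 j) //= evE mul_mpolyC -scalerAl -mul_mpolyC.
    by rewrite mul_mpolyC; congr (_ *: _); rewrite [RHS]mulrC -mulrA.
  apply: ideal_sum => // j _; apply: (IM _ _ _); apply: IM.
  have := hmb s`_j; have [-> _] := hs j; rewrite /=.
  by rewrite /ev rmorphB /= map_polyX map_polyC !hornerE.
apply: (Iw (m0 + m1)%N); rewrite exprD.
have -> : w ^+ m0 * w ^+ m1 = w ^+ m0 * (w ^+ m1 - q * ev p) + q * (w ^+ m0 * ev p).
  by rewrite mulrBr mulrCA subrK.
by apply: ID; apply: IM.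
Qed.

(** If no power of [w] is in [I], coordinates z_i are chosen one at a time, adjoining X_i - z_i
    while keeping every power of [w] outside. In the end f = f(z) modulo [J] and no nonzero constant
    is in [J], so z is a zero of [I]; then w(z) = 0 puts [w] itself in [J]. *)
Theorem nullstellensatz I (w : {mpoly K[n]}) : is_ideal I ->
  (forall z, (forall f, I f -> f.@[z] = 0) -> w.@[z] = 0) -> exists m, I (w ^+ m).
Proof.
move=> Iid hw; apply: contrapT => /forallNP Iw.
have /(_ n) [J [z [Jid IJ Jw Jz]]] k : exists J (z : 'I_n -> K),
    [/\ is_ideal J, forall f, I f -> J f, forall m, ~ J (w ^+ m)
      & forall i : 'I_n, (i < k)%N -> J ('X_i - (z i)%:MP)].
  elim: k => [|k [J [z [Jid IJ Jw Jz]]]]; first by exists I, (fun=> 0).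
  have [nk|kn] := leqP n k.
    by exists J, z; split=> // i _; apply: Jz; apply: leq_trans nk.
  have [x hx] := @adjoin_coordinate J w (Ordinal kn) Jid Jw.
  have [J'id JJ' J'x] := adjoin_idealP ('X_(Ordinal kn) - x%:MP) Jid.
  exists (adjoin_ideal J ('X_(Ordinal kn) - x%:MP)).
  exists (fun i => if i == Ordinal kn then x else z i); split=> // [f /IJ|i]; first exact: JJ'.
  case: eqP => [->//|ni]; rewrite ltnS leq_eqVlt => /predU1P[ik|/Jz/JJ'//].
  by case: ni; apply: val_inj.
have [J0 JD JM] := Jid.
have sub f : J (f - (f.@[z])%:MP).
  elim/mpoly_ring_ind: f => [c|i|f g Df Dg|f g Df Dg].
  - by rewrite mevalC subrr.
  - by rewrite mevalXU; apply: Jz.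
  - by rewrite mevalD mpolyCD opprD addrACA; apply: JD.
  rewrite mevalM mpolyCM.
  have -> : f * g - f.@[z]%:MP * g.@[z]%:MP =
    f * (g - g.@[z]%:MP) + g.@[z]%:MP * (f - f.@[z]%:MP) by ring.
  by apply: JD; apply: JM.
have Jc c : J c%:MP -> c = 0.
  move=> Jc; apply: contrapT => /eqP c0; apply: (Jw 0%N).
  by rewrite expr0 -(mpolyC1 n K) -(mulVf c0) mpolyCM; apply: JM.
have wz : w.@[z] = 0.
  apply: hw => f /IJ Jf; apply: Jc.
  rewrite -[X in J X](subKr f); exact: idealB Jid Jf (sub f).
by apply: (Jw 1%N); move: (sub w); rewrite expr1 wz mpolyC0 subr0.
Qed.

Lemma mpoly_nonvanishing (f : {mpoly K[n]}) : f != 0 -> exists z, f.@[z] != 0.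
Proof.
move=> f0; apply: contrapT => /forallNP h.
have [||m] := @nullstellensatz (fun g => g = 0) f.
- by split=> [|g h' -> ->|g h' ->]; rewrite ?addr0 ?mulr0.
- by move=> z _; apply/eqP; apply: contrapT => /negP /h.
- by move/eqP; rewrite expf_eq0 (negPf f0) andbF.
Qed.

End Null.

(** * Saturation of ideals generated by regular pairs *)

(** [P] is a nonzerodivisor modulo [Q]. The ideal (P, Q) may be the whole ring, which covers an
    empty Z. *)
Definition regular_pair (A : comPzRingType) (P Q : A) :=
  forall f g, P * f = Q * g -> exists h, f = Q * h.

Section Homogeneous.
Context (n : nat) (R : idomainType).
Implicit Types (f g : {mpoly R[n]}).

(** Lets the cofactors in a membership relation between forms be replaced by their homogeneous
    parts. *)
Lemma pihomogM_homog d e f g : f \is d.-homog ->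
  pihomog mdeg (e + d) (g * f) = pihomog mdeg e g * f.
Proof.
move=> hf; rewrite [in LHS](pihomog_partitionE (leqnn (mmeasure mdeg g))).
rewrite mulr_suml raddf_sum /=.
have hom b : pihomog mdeg b g * f \is (b + d).-homog by apply: dhomogM => //; apply: pihomogP.
have [lt|ge] := ltnP e (msize g).
  rewrite (bigD1 (Ordinal lt)) //= big1 ?addr0 => [|b be].
    by rewrite pihomog_dE.
  rewrite (pihomog_ne0 _ (hom b)) // eqn_add2r.
  exact: be.
rewrite big1 => [|b _]; last first.
  rewrite (pihomog_ne0 _ (hom b)) // eqn_add2r neq_ltn.
  by rewrite (leq_trans (ltn_ord b)).
rewrite pihomogE big_seq_cond big1 ?mul0r // => m /andP[mg /eqP md].
by have := msize_mdeg_lt mg; rewrite md ltnNge ge.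
Qed.

Lemma pihomogM_small d e f g : f \is d.-homog -> (e < d)%N ->
  pihomog mdeg e (g * f) = 0.
Proof.
move=> hf ed; rewrite [in LHS](pihomog_partitionE (leqnn (mmeasure mdeg g))).
rewrite mulr_suml raddf_sum /= big1 // => b _.
rewrite (@pihomog_ne0 _ _ mdeg (b + d)%N e) //; first by rewrite neq_ltn ltn_addl ?orbT.
by apply: dhomogM => //; apply: pihomogP.
Qed.

Lemma dhomog0_const f : f \is 0.-homog -> f = (f@_0)%:MP.
Proof.
move=> hf; apply: msize1_polyC; rewrite msizeE; apply/bigmax_leqP_seq => m mf _.
by rewrite (dhomog_mf hf mf).
Qed.

Lemma homog_dvd e d (B f : {mpoly R[n]}) : B \is d.-homog -> f \is e.-homog -> (exists u, f = u * B) ->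
  f = 0 \/ (d <= e)%N /\ exists u, u \is (e - d).-homog /\ f = u * B.
Proof.
move=> hB hf [u E]; have [de|ed] := leqP d e.
  right; split=> //; exists (pihomog mdeg (e - d) u); rewrite pihomogP; split=> //.
  by rewrite -(pihomogM_homog _ _ hB) subnK // -E pihomog_dE.
by left; rewrite -(pihomog_dE hf) E (pihomogM_small _ hB).
Qed.

End Homogeneous.

Section Saturation.
Context (n : nat) (K : fieldType).
Implicit Types (f g P Q : {mpoly K[n]}).

(** Reduction modulo X_j, realised as an endomorphism of the polynomial ring instead of a quotient
    map. *)
Definition kill_var (j : 'I_n) f := f \mPo [tuple if i == j then 0 else 'X_i | i < n].

Lemma kill_varX j i : kill_var j 'X_i = if i == j then 0 else 'X_i.
Proof. by rewrite /kill_var comp_mpolyXU -tnth_nth tnth_mktuple. Qed.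

Lemma kill_varM j f g : kill_var j (f * g) = kill_var j f * kill_var j g.
Proof. exact: rmorphM. Qed.

Lemma kill_varN j f : kill_var j (- f) = - kill_var j f.
Proof. exact: rmorphN. Qed.

Lemma kill_varD j f g : kill_var j (f + g) = kill_var j f + kill_var j g.
Proof. exact: rmorphD. Qed.

Lemma kill_var0 j : kill_var j 0 = 0.
Proof. exact: rmorph0. Qed.

Lemma kill_varP j f : exists g, f = kill_var j f + 'X_j * g.
Proof.
elim/mpoly_ring_ind: f => [c|i|f g [a Ea] [b Eb]|f g [a Ea] [b Eb]].
- by exists 0; rewrite /kill_var comp_mpolyC mulr0 addr0.
- have [->|ij] := eqVneq i j; first by exists 1; rewrite kill_varX eqxx add0r mulr1.
  by exists 0; rewrite kill_varX (negPf ij) mulr0 addr0.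
- by exists (a + b); rewrite kill_varD {1}Ea {1}Eb; ring.
exists (kill_var j f * b + a * kill_var j g + 'X_j * (a * b)).
by rewrite kill_varM {1}Ea {1}Eb; ring.
Qed.

Lemma kill_var_dvd j f : kill_var j f = 0 -> exists g, f = 'X_j * g.
Proof. by have [g E] := kill_varP j f => kf; exists g; rewrite E kf add0r. Qed.

Lemma mpolyX_neq0 (i : 'I_n) : 'X_i != 0 :> {mpoly K[n]}.
Proof. by rewrite -msize_poly_eq0 mmeasureX. Qed.

Lemma mpolyX_regular (i j : 'I_n) : i != j -> regular_pair ('X_i : {mpoly K[n]}) 'X_j.
Proof.
move=> ij f g E; apply: kill_var_dvd; have := congr1 (kill_var j) E.
rewrite !kill_varM !kill_varX (negPf ij) eqxx mul0r => /eqP.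
by rewrite mulf_eq0 (negPf (mpolyX_neq0 i)) => /eqP.
Qed.

(** A Koszul argument. Comparing the expressions of X_i f and X_j f gives syzygies of (P, Q), hence
    multipliers w_ij, which satisfy the cocycle relation [Ew]. As three variables form a regular
    sequence, w01 lies in (X_0, X_1); this corrects u0 and v0 by a trivial syzygy so that both
    become divisible by X_0. *)
Lemma regular_pair_saturated P Q (i0 i1 i2 : 'I_n) f :
  i0 != i1 -> i0 != i2 -> i1 != i2 -> P != 0 -> Q != 0 -> regular_pair P Q ->
  (forall i, exists u v, 'X_i * f = u * P + v * Q) -> exists u v, f = u * P + v * Q.
Proof.
move=> n01 n02 n12 P0 Q0 PQ hf.
have [u0 [v0 E0]] := hf i0; have [u1 [v1 E1]] := hf i1; have [u2 [v2 E2]] := hf i2.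
have syz i j u v u' v' : 'X_i * f = u * P + v * Q -> 'X_j * f = u' * P + v' * Q ->
    exists w, 'X_j * u - 'X_i * u' = Q * w /\ 'X_i * v' - 'X_j * v = P * w.
  move=> E E'.
  have EE : P * ('X_j * u - 'X_i * u') = Q * ('X_i * v' - 'X_j * v).
    apply/eqP; rewrite -subr_eq0; apply/eqP.
    transitivity ('X_j * (u * P + v * Q) - 'X_i * (u' * P + v' * Q)); first by ring.
    by rewrite -E -E'; ring.
  have [w Ew] := PQ _ _ EE; exists w; split=> //.
  by apply: (mulfI Q0); rewrite -EE Ew; ring.
have [w01 [A01 B01]] := syz _ _ _ _ _ _ E0 E1.
have [w02 [A02 B02]] := syz _ _ _ _ _ _ E0 E2.
have [w12 [A12 B12]] := syz _ _ _ _ _ _ E1 E2.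
have Ew : 'X_i2 * w01 - 'X_i1 * w02 + 'X_i0 * w12 = 0.
  apply: (mulfI Q0); rewrite mulr0.
  transitivity ('X_i2 * (Q * w01) - 'X_i1 * (Q * w02) + 'X_i0 * (Q * w12)); first by ring.
  by rewrite -A01 -A02 -A12; ring.
have [y0 [y1 Ey]] : exists y0 y1, w01 = 'X_i0 * y0 + 'X_i1 * y1.
  have [y0 E] := kill_varP i0 w01.
  have [y1 E'] : exists y, kill_var i0 w01 = 'X_i1 * y.
    apply: kill_var_dvd; have /(congr1 (kill_var i1)) := congr1 (kill_var i0) Ew.
    rewrite !(kill_varD, kill_varN, kill_varM, kill_varX, kill_var0).
    rewrite eqxx [i1 == i0]eq_sym (negPf n01) [i2 == i0]eq_sym (negPf n02).
    rewrite !(kill_varX, kill_var0, mul0r, kill_varN) eqxx [i2 == i1]eq_sym (negPf n12) !(mul0r, oppr0).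
    rewrite !addr0 => /eqP.
    by rewrite mulf_eq0 (negPf (mpolyX_neq0 i2)) => /eqP.
  by exists y0, y1; rewrite E E' addrC.
have [u Eu] : exists u, u0 - Q * y1 = 'X_i0 * u.
  apply: (mpolyX_regular (i := i1) (j := i0)) (u1 + Q * y0) _; first by rewrite eq_sym.
  apply/eqP; rewrite -subr_eq0; apply/eqP.
  transitivity ('X_i1 * u0 - 'X_i0 * u1 - Q * ('X_i0 * y0 + 'X_i1 * y1)); first by ring.
  by rewrite A01 Ey subrr.
have [v Ev] : exists v, v0 + P * y1 = 'X_i0 * v.
  apply: (mpolyX_regular (i := i1) (j := i0)) (v1 - P * y0) _; first by rewrite eq_sym.
  apply/eqP; rewrite -subr_eq0; apply/eqP.
  transitivity (P * ('X_i0 * y0 + 'X_i1 * y1) - ('X_i0 * v1 - 'X_i1 * v0)); first by ring.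
  by rewrite B01 Ey subrr.
exists u, v; apply: (mulfI (mpolyX_neq0 i0)); rewrite E0.
transitivity ((u0 - Q * y1) * P + (v0 + P * y1) * Q); first by ring.
by rewrite Eu Ev; ring.
Qed.

(** A monomial whose degree exceeds the sum of the e_i is divisible by some X_i ^ e_i, so all
    monomials of that degree carry [f] into [I]; saturation then lowers the degree one step at a
    time. *)
Lemma power_saturated (I : {mpoly K[n]} -> Prop) f : is_ideal I ->
  (forall g, (forall i, I ('X_i * g)) -> I g) ->
  (forall i, exists m, I ('X_i ^+ m * f)) -> I f.
Proof.
move=> [_ _ IM] sat /choice [e he].
have IX N g : (forall m, mdeg m = N -> I ('X_[m] * g)) -> I g.
  elim: N g => [|N IH] g hg.
    by have := hg 0%MM (@mdeg0 n); rewrite mpolyX0 mul1r.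
  apply: sat => i; apply: IH => m mN; rewrite mulrA -mpolyXD; apply: hg.
  by rewrite mdegD mdeg1 mN addn1.
apply: (IX (\sum_i e i).+1) => m mN.
have [i ei] : exists i, (e i <= m i)%N.
  apply: contrapT => /forallNP h.
  have : (mdeg m <= \sum_i e i)%N.
    by rewrite mdegE; apply: leq_sum => i _; have /negP := h i; rewrite -ltnNge => /ltnW.
  by rewrite mN ltnn.
have -> : m = ((m - U_(i) *+ e i) + U_(i) *+ e i)%MM.
  rewrite submK //; apply/mnm_lepP => j; rewrite mulmnE mnm1E.
  by case: eqP => [<-|_]; rewrite ?mul1n ?mul0n.
by rewrite mpolyXD -mulrA -mpolyXn; apply: IM.
Qed.

End Saturation.

(** * From conditions on stalks to ideal membership *)

Section Ideals.
Context (K : fieldType) (n : nat).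
Implicit Types (f g P Q B : {mpoly K[n.+1]}) (gs : seq {mpoly K[n.+1]}).

Lemma in_idealP gs : is_ideal (in_ideal gs).
Proof.
split.
- by exists (fun=> 0); rewrite big1 // => i _; rewrite mul0r.
- move=> f g [u ->] [v ->]; exists (fun i => u i + v i).
  by rewrite -big_split; apply: eq_bigr => i _; rewrite mulrDl.
- move=> f g [u ->]; exists (fun i => f * u i).
  by rewrite mulr_sumr; apply: eq_bigr => i _; rewrite mulrA.
Qed.

Lemma in_ideal1 B f : in_ideal [:: B] f <-> exists u, f = u * B.
Proof.
split=> [[u ->]|[u ->]]; first by exists (u 0%N); rewrite big_ord1.
by exists (fun=> u); rewrite big_ord1.
Qed.

Lemma in_ideal2 P Q f : in_ideal [:: P; Q] f <-> exists u v, f = u * P + v * Q.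
Proof.
split=> [[u ->]|[u [v ->]]].
  by exists (u 0%N), (u 1%N); rewrite big_ord_recl big_ord1.
by exists (fun i => if i == 0%N then u else v); rewrite big_ord_recl big_ord1.
Qed.

Lemma in_ideal3 P Q T f :
  in_ideal [:: P; Q; T] f <-> exists a b c, f = a * P + b * Q + c * T.
Proof.
split=> [[u ->]|[u [v [w ->]]]].
  by exists (u 0%N), (u 1%N), (u 2%N); rewrite !big_ord_recl big_ord0 addr0 addrA.
exists (fun i => if i == 0%N then u else if i == 1%N then v else w).
by rewrite !big_ord_recl big_ord0 addr0 addrA.
Qed.

Lemma in_stalk_ideal gs z f : in_ideal gs f -> in_stalk gs z f.
Proof. by move=> h; exists 1; rewrite ?meval1 ?oner_neq0 ?mul1r. Qed.

End Ideals.

Section LocalGlobal.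
Context (K : closedFieldType) (n : nat).
Hypothesis uK : uncountable K.
Hypothesis hn : (2 <= n)%N.
Implicit Types (f g P Q B : {mpoly K[n.+1]}) (gs : seq {mpoly K[n.+1]}).

(** The Nullstellensatz is applied to the ideal of all s with s f in (gs): the local hypothesis says
    that its only possible zero is the origin, where the X_i vanish. *)
Lemma stalks_power gs f : (forall z, is_point z -> in_stalk gs z f) ->
  forall i, exists m, in_ideal gs ('X_i ^+ m * f).
Proof.
move=> hf i; have [_ ID IM] := in_idealP gs.
apply: (nullstellensatz uK (I := fun s => in_ideal gs (s * f))).
  split=> [|s t hs ht|s t ht].
  - by rewrite mul0r; exact: (let: And3 h _ _ := in_idealP gs in h).
  - by rewrite mulrDl; apply: ID.
  - by rewrite -mulrA; apply: IM.
move=> z hz; rewrite mevalXU; apply/eqP; apply: contrapT => /negP zi.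
have [s sz sf] := hf z (ex_intro _ i zi).
by move: sz; rewrite hz // eqxx.
Qed.

Lemma stalks_in_ideal2 P Q f : P != 0 -> Q != 0 -> regular_pair P Q ->
  (forall z, is_point z -> in_stalk [:: P; Q] z f) -> in_ideal [:: P; Q] f.
Proof.
move=> P0 Q0 PQ hf; apply: (power_saturated (in_idealP _) _ (stalks_power hf)).
move=> g hg; apply/in_ideal2.
apply: (@regular_pair_saturated _ _ P Q ord0 (inord 1) (inord 2)) => //.
- by rewrite -val_eqE /= !inordK //; lia.
- by rewrite -val_eqE /= inordK //; lia.
- by rewrite -val_eqE /= !inordK // ltnW.
- by move=> i; apply/in_ideal2.
Qed.

(* An equation of the square of the ideal is first written as u P + v Q; regularity of the
   pair then shows that u and v are locally, hence globally, in the ideal. *)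
Lemma stalks_in_ideal_square P Q f : P != 0 -> Q != 0 -> regular_pair P Q ->
  (forall z, is_point z -> in_stalk [:: P ^+ 2; P * Q; Q ^+ 2] z f) ->
  exists a b c, f = a * P ^+ 2 + b * (P * Q) + c * Q ^+ 2.
Proof.
move=> P0 Q0 PQ hf.
have /in_ideal2 [u [v Ef]] : in_ideal [:: P; Q] f.
  apply: stalks_in_ideal2 => // z /hf [s sz /in_ideal3 [a [b [c E]]]].
  by exists s => //; apply/in_ideal2; exists (a * P + b * Q), (c * Q); rewrite E; ring.
have huv z : is_point z -> in_stalk [:: P; Q] z u /\ in_stalk [:: P; Q] z v.
  move=> /hf [s sz /in_ideal3 [a [b [c E]]]].
  have E' : P * (s * u - a * P - b * Q) = Q * (c * Q - s * v).
    apply/eqP; rewrite -subr_eq0; apply/eqP.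
    transitivity (s * (u * P + v * Q) - (a * P ^+ 2 + b * (P * Q) + c * Q ^+ 2)); first by ring.
    by rewrite -Ef E subrr.
  have [h Eh] := PQ _ _ E'.
  have Eh' : c * Q - s * v = P * h by apply: (mulfI Q0); rewrite -E' Eh; ring.
  split; exists s => //; apply/in_ideal2.
    exists a, (b + h); apply/eqP; rewrite -subr_eq0; apply/eqP.
    by transitivity (s * u - a * P - b * Q - Q * h); [ring|rewrite Eh subrr].
  exists (- h), c; apply/eqP; rewrite -subr_eq0; apply/eqP.
  by transitivity (P * h - (c * Q - s * v)); [ring|rewrite Eh' subrr].
have /in_ideal2 [a [b Eu]] : in_ideal [:: P; Q] u.
  by apply: stalks_in_ideal2 => // z /huv [].
have /in_ideal2 [a' [b' Ev]] : in_ideal [:: P; Q] v.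
  by apply: stalks_in_ideal2 => // z /huv [].
by exists a, (b + a'), b'; rewrite Ef Eu Ev; ring.
Qed.

End LocalGlobal.

Section HomogeneousIdeals.
Context (K : fieldType) (n : nat).
Implicit Types (f g P Q B : {mpoly K[n.+1]}).

Lemma homog_in_ideal2 p q e P Q f : P \is p.-homog -> Q \is q.-homog -> f \is e.-homog ->
  (p <= e)%N -> (q <= e)%N -> in_ideal [:: P; Q] f ->
  exists u v, [/\ u \is (e - p).-homog, v \is (e - q).-homog & f = u * P + v * Q].
Proof.
move=> hP hQ hf pe qe /in_ideal2 [u [v E]].
exists (pihomog mdeg (e - p) u), (pihomog mdeg (e - q) v).
rewrite !pihomogP -(pihomogM_homog _ _ hP) -(pihomogM_homog _ _ hQ) !subnK //.
by split=> //; rewrite -raddfD /= -E pihomog_dE.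
Qed.

Lemma homog_in_ideal3 p q t e P Q T f :
  P \is p.-homog -> Q \is q.-homog -> T \is t.-homog -> f \is e.-homog ->
  (p <= e)%N -> (q <= e)%N -> (t <= e)%N ->
  (exists a b c, f = a * P + b * Q + c * T) ->
  exists a b c, [/\ a \is (e - p).-homog, b \is (e - q).-homog, c \is (e - t).-homog
    & f = a * P + b * Q + c * T].
Proof.
move=> hP hQ hT hf pe qe te [u [v [w E]]].
exists (pihomog mdeg (e - p) u), (pihomog mdeg (e - q) v), (pihomog mdeg (e - t) w).
rewrite !pihomogP -(pihomogM_homog _ _ hP) -(pihomogM_homog _ _ hQ) -(pihomogM_homog _ _ hT).
by rewrite !subnK //; split=> //; rewrite -[LHS](pihomog_dE hf) E !raddfD.
Qed.

Lemma homog_in_ideal2_small p q e P Q f : P \is p.-homog -> Q \is q.-homog ->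
  f \is e.-homog -> (e < p)%N -> (e < q)%N -> in_ideal [:: P; Q] f -> f = 0.
Proof.
move=> hP hQ hf ep eq /in_ideal2 [u [v E]].
by rewrite -(pihomog_dE hf) E raddfD /= (pihomogM_small _ hP) // (pihomogM_small _ hQ) // addr0.
Qed.

End HomogeneousIdeals.

(** * Elimination on lines *)

Section Elimination.
Context (R : idomainType).
Implicit Types (f g y w s : {poly R}).

(* Adding a large multiple of f to g makes the formal degrees of both arguments of the
   resultant visible on f, so that the resultant commutes with specialisations. *)
Lemma elimination f g : f != 0 ->
  exists (N : R) (u v : {poly R}), N%:P = u * f + v * g /\
    forall (F : fieldType) (phi : {rmorphism R -> F}), phi (lead_coef f) != 0 ->
      (phi N != 0) = coprimep (map_poly phi f) (map_poly phi g).
Proof.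
move=> f0; have [f1|f1] := leqP (size f) 1.
  exists (lead_coef f), 1, 0; rewrite mul0r addr0 mul1r.
  have fE : f = (lead_coef f)%:P by rewrite lead_coefE {1}(size1_polyC f1); case: (size f) f1 => [|[]].
  split=> // F phi hphi; rewrite hphi fE map_polyC /=.
  by rewrite -coprimep_sym -alg_polyC coprimepZr // coprimep1.
pose M := size g; pose g' := g + f * 'X^M.
have sg' : size g' = (size f + M)%N.
  by rewrite /g' addrC size_polyDl size_mulXn // /M addnC //; lia.
have lg' : lead_coef g' = lead_coef f.
  rewrite /g' addrC lead_coefDl ?lead_coef_Mmonic ?monicXn // size_mulXn // /M; lia.
have [||[u v] /= _ E] := @resultant_in_ideal R f g' => //; first by rewrite sg'; lia.
exists (resultant f g'), (u + v * 'X^M), v; split.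
  by rewrite E /g'; ring.
move=> F phi hphi.
have mg' : map_poly phi g' = map_poly phi f * 'X^M + map_poly phi g.
  by rewrite /g' rmorphD rmorphM /= map_polyXn addrC.
have fphi0 : map_poly phi f != 0.
  by rewrite -lead_coef_eq0 lead_coef_map_id0 // rmorph0.
have -> : phi (resultant f g') = resultant (map_poly phi f) (map_poly phi g').
  rewrite /resultant /Sylvester_mx !size_map_poly_id0 ?lg' //.
  rewrite -det_map_mx /= map_col_mx; congr (\det (col_mx _ _));
    by apply: map_lin1_mx => r; rewrite map_poly_rV rmorphM /= map_rVpoly.
rewrite resultant_eq0 -leqNgt mg' /coprimep [in RHS]eqn_leq.
have -> : (0 < size (gcdp (map_poly phi f) (map_poly phi g)))%N.
  by rewrite size_poly_gt0 gcdp_eq0 negb_and fphi0.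
rewrite andbT.
have := coprimep_addl_mul 'X^M (map_poly phi g) (map_poly phi f).
rewrite /coprimep mulrC !eqn_leq !size_poly_gt0 !gcdp_eq0 !negb_and fphi0 !andbT.
by move=> ->.
Qed.

Lemma divide_unit_lead f y : lead_coef f \is a GRing.unit ->
  exists q r, y = q * f + r /\ (size r < size f)%N.
Proof.
move=> uf; have f0 : f != 0 by apply: contraTneq uf => ->; rewrite lead_coef0 unitr0.
by exists (y %/ f), (y %% f); rewrite -Pdiv.IdomainUnit.divp_eq // ltn_modp.
Qed.

Lemma small_multiple_eq0 f (r s : {poly R}) : (size r < size f)%N -> r = s * f -> s = 0 /\ r = 0.
Proof.
move=> rf E; suff s0 : s = 0 by rewrite E s0 mul0r.
have f0 : f != 0 by apply: contraTneq rf => ->; rewrite size_poly0.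
apply/eqP; apply: contraLR rf => s0; rewrite -leqNgt E size_mul //.
by rewrite -size_poly_gt0 in s0; rewrite -(prednK s0) addSn leq_addl.
Qed.

Lemma const_regular f N y w : lead_coef f \is a GRing.unit -> N != 0 ->
  N%:P * y = w * f -> exists h, y = h * f.
Proof.
move=> uf N0 E; have [q [r [Ey rf]]] := divide_unit_lead y uf.
have [] := @small_multiple_eq0 f (N%:P * r) (w - N%:P * q).
- by rewrite size_Cmul.
- by rewrite mulrBl -E Ey; ring.
move=> _ /eqP; rewrite mulf_eq0 polyC_eq0 (negPf N0) => /eqP r0.
by exists q; rewrite Ey r0 addr0.
Qed.

(** After division by [f], both sides are remainders of degree less than that of [f] and can be
    compared coefficient by coefficient in [R]. *)
Lemma const_pair_regular f N rho y w s : lead_coef f \is a GRing.unit ->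
  regular_pair N rho -> N%:P * y = rho%:P * w + s * f ->
  exists h t, y = rho%:P * h + t * f.
Proof.
move=> uf reg E; have [q [r [Ey rf]]] := divide_unit_lead y uf.
have [q' [r' [Ew rf']]] := divide_unit_lead w uf.
have [||_ Er] := @small_multiple_eq0 f (N%:P * r - rho%:P * r') (s + rho%:P * q' - N%:P * q).
- rewrite (leq_ltn_trans (size_polyD _ _)) // size_polyN gtn_max !mul_polyC.
  by rewrite !(leq_ltn_trans (size_scale_leq _ _)).
- apply/eqP; rewrite -subr_eq0; apply/eqP.
  transitivity (N%:P * y - (rho%:P * w + s * f)); last by rewrite E subrr.
  by rewrite Ey Ew; ring.
have /choice [h hh] : forall i, exists h, r`_i = rho * h.
  move=> i; apply: (reg _ r'`_i); apply/eqP; rewrite -subr_eq0; apply/eqP.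
  by have /(congr1 (fun p : {poly R} => p`_i)) := Er; rewrite coefB !coefCM coef0.
exists (\poly_(i < size r) h i), q; rewrite Ey addrC; congr (_ + _).
apply/polyP => i; rewrite coefCM coef_poly; case: ltnP => // ri.
by rewrite nth_default // mulr0.
Qed.

(* Multiplication by rho = v q and by N = v' c modulo f is componentwise on the free
   module R[T]/(f); this reduces the regularity of (f, q, c) to that of (N, rho) in R. *)
Lemma triple_regular f q c rho N u v u' v' y a b : lead_coef f \is a GRing.unit ->
  rho != 0 -> rho%:P = u * f + v * q -> N%:P = u' * f + v' * c -> regular_pair N rho ->
  c * y = a * f + b * q -> exists s t, y = s * f + t * q.
Proof.
move=> uf rho0 Erho EN reg E.
(* Modulo [f], the factor [v] turns [q] into [rho] and [v'] turns [c] into [N]; so the relation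
   becomes N (v y) = rho (v' b) modulo [f]. *)
have [|h [t Eh]] := @const_pair_regular f N rho (v * y) (v' * b)
    (v * u' * y + v * v' * a - v' * b * u) uf reg.
  transitivity (v * (u' * f * y + v' * (c * y))); first by rewrite EN; ring.
  by rewrite E Erho; ring.
have [|s Es] := @const_regular f rho (y - h * q) (u * y + q * t) uf rho0.
  transitivity ((u * f + v * q) * y - rho%:P * h * q); first by rewrite -Erho; ring.
  transitivity (u * f * y + q * (v * y) - rho%:P * h * q); first by ring.
  by rewrite Eh; ring.
by exists s, h; rewrite -Es; ring.
Qed.

End Elimination.

(** * Restriction of polynomials to lines *)

Lemma rmorph_mmap (n : nat) (A : nzRingType) (S S' : comNzRingType) (phi : {rmorphism S -> S'})
    (f : {rmorphism A -> S}) (h : 'I_n -> S) (F : {mpoly A[n]}) :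
  phi (mmap f h F) = mmap (phi \o f) (phi \o h) F.
Proof.
rewrite /mmap rmorph_sum; apply: eq_bigr => m _; rewrite rmorphM /=; congr (_ * _).
by rewrite /mmap1 rmorph_prod; apply: eq_bigr => i _; rewrite rmorphXn.
Qed.

Lemma eq_mmap (n : nat) (A S : nzRingType) (f f' : A -> S) (h h' : 'I_n -> S)
    (F : {mpoly A[n]}) : f =1 f' -> h =1 h' -> mmap f h F = mmap f' h' F.
Proof.
move=> ef eh; rewrite /mmap; apply: eq_bigr => m _; rewrite ef; congr (_ * _).
exact: mmap1_eq.
Qed.

Section Along.
Context (A : nzRingType) (n : nat) (S : comNzRingType) (f : {rmorphism A -> S}).
Implicit Types (F : {mpoly A[n]}).

(** The target ring [S] is arbitrary, so that one definition covers the line through a point, the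
    line through the generic point X, and lines for polynomials whose coefficients depend on
    parameters. *)
Definition along (a b : 'I_n -> S) F : {poly S} :=
  mmap (polyC \o f) (fun i => (a i)%:P + b i *: 'X) F.

HB.instance Definition _ a b :=
  GRing.RMorphism.copy (along a b) (mmap (polyC \o f) (fun i => (a i)%:P + b i *: 'X)).

Lemma horner_along a b F t : (along a b F).[t] = mmap f (fun i => a i + t * b i) F.
Proof.
rewrite /along -[LHS]/(horner_eval t _) rmorph_mmap /=; apply: eq_mmap => i /=.
  by rewrite /horner_eval hornerC.
by rewrite /horner_eval !hornerE mulrC.
Qed.

(** A formal leading coefficient: [c] may be 0, which makes it multiplicative without any
    hypothesis. *)
Definition top_coef (d : nat) (p : {poly S}) (c : S) := (size p <= d.+1)%N /\ p`_d = c.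

Lemma top_coefM d e (p q : {poly S}) c c' : top_coef d p c -> top_coef e q c' ->
  top_coef (d + e) (p * q) (c * c').
Proof.
move=> [sp pd] [sq qe]; split.
  by rewrite (leq_trans (size_polyMleq _ _)) //; lia.
have dlt : (d < (d + e).+1)%N by rewrite ltnS leq_addr.
rewrite coefM (bigD1 (Ordinal dlt)) //= addKn pd qe big1 ?addr0 // => i id.
have [di|di] := ltnP d i.
  by rewrite nth_default ?mul0r // (leq_trans sp).
have {}di : (i < d)%N by rewrite ltn_neqAle di andbT; exact: id.
rewrite [q`_ _]nth_default ?mulr0 // (leq_trans sq) //; lia.
Qed.

Lemma top_coef_along a b F d : (msize F <= d.+1)%N ->
  top_coef d (along a b F) (mmap f b (pihomog mdeg d F)).
Proof.
move=> hF.
have topX m : top_coef (mdeg m) (mmap1 (fun i => (a i)%:P + b i *: 'X) m) (mmap1 b m).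
  rewrite /mmap1 mdegE; elim/big_rec3: _ => [|i y z w _ IH].
    by split; rewrite ?size_poly1 ?coefC.
  apply: top_coefM => //; elim: (m i) => [|k IHk]; first by split; rewrite ?size_poly1 ?coefC.
  rewrite !exprS -add1n; apply: top_coefM => //; split.
    rewrite (leq_trans (size_polyD _ _)) // geq_max (leq_trans (size_polyC_leq1 _)) //=.
    by rewrite (leq_trans (size_scale_leq _ _)) ?size_polyX.
  by rewrite coefD coefC coefZ coefX mulr1 add0r.
rewrite /along /mmap pihomogE; split.
  rewrite (leq_trans (size_sum _ _ _)) //; apply/bigmax_leqP_seq => m mF _ /=.
  rewrite mul_polyC (leq_trans (size_scale_leq _ _)) //.
  have [h _] := topX m; rewrite (leq_trans h) // ltnS.
  by rewrite -ltnS (leq_trans (msize_mdeg_lt mF)).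
rewrite coef_sum -/(mmap f b _) raddf_sum /= [RHS]big_mkcond /=.
apply: eq_big_seq => m mF; rewrite coefCM; have [hm Em] := topX m.
case: eqP => [<-|md]; first by rewrite Em mmapZ mmapX.
rewrite nth_default ?mulr0 // (leq_trans hm) //.
by have := leq_trans (msize_mdeg_lt mF) hF; move/eqP: md; lia.
Qed.

End Along.

Section Lines.
Context (K : fieldType) (n : nat).
Implicit Types (F G : {mpoly K[n]}) (x p q : 'I_n -> K).

Lemma on_line_sig : {f : ('I_n -> K) -> ('I_n -> K) -> {mpoly K[n]} -> {poly K} |
  forall x p F, f x p F = along idfun x p F}.
Proof. by exists (fun x p F => along idfun x p F). Qed.

Lemma line_poly_sig : {f : ('I_n -> K) -> {mpoly K[n]} -> {poly {mpoly K[n]}} |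
  forall p F, f p F = along (@mpolyC n K) (fun i => 'X_i) (fun i => (p i)%:MP) F}.
Proof. by exists (fun p F => along (@mpolyC n K) (fun i => 'X_i) (fun i => (p i)%:MP) F). Qed.

(* Sealed: unfolding these in failed unifications is prohibitively slow. *)
Definition on_line := sval on_line_sig.
Definition line_poly := sval line_poly_sig.

Lemma on_lineE x p F : on_line x p F = along idfun x p F.
Proof. exact: (svalP on_line_sig). Qed.

Lemma line_polyE p F :
  line_poly p F = along (@mpolyC n K) (fun i => 'X_i) (fun i => (p i)%:MP) F.
Proof. exact: (svalP line_poly_sig). Qed.

Lemma horner_on_line x p F t : (on_line x p F).[t] = F.@[fun i => x i + t * p i].
Proof. by rewrite on_lineE horner_along. Qed.

Lemma top_coef_on_line x p F d : (msize F <= d.+1)%N ->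
  top_coef d (on_line x p F) (pihomog mdeg d F).@[p].
Proof. by rewrite on_lineE; apply: top_coef_along. Qed.

Lemma mmap_mpolyC q F : mmap (@mpolyC n K) (fun i => (q i)%:MP) F = (F.@[q])%:MP :> {mpoly K[n]}.
Proof.
rewrite /meval rmorph_mmap; exact: eq_mmap.
Qed.

Lemma top_coef_line_poly p F d : (msize F <= d.+1)%N ->
  top_coef d (line_poly p F) ((pihomog mdeg d F).@[p])%:MP.
Proof. by move=> h; rewrite -mmap_mpolyC line_polyE; apply: top_coef_along. Qed.

Lemma line_poly0 p F : (line_poly p F).[0] = F.
Proof.
rewrite line_polyE horner_along -[RHS]comp_mpoly_id /comp_mpoly; apply: eq_mmap => // i.
by rewrite mul0r addr0 tnth_mktuple.
Qed.

Lemma map_line_poly x p F : map_poly (meval x) (line_poly p F) = on_line x p F.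
Proof.
rewrite line_polyE on_lineE /along -[LHS]/(map_poly (meval x) _) rmorph_mmap.
apply: eq_mmap => i /=; first by rewrite map_polyC /= mevalC.
by rewrite rmorphD /= map_polyC /= mevalXU map_polyZ map_polyX /= mevalC.
Qed.

Definition translate q F := F \mPo [tuple 'X_i + (q i)%:MP | i < n].

Lemma horner_line_poly p F t : (line_poly p F).[t%:MP] = translate (fun i => t * p i) F.
Proof.
rewrite line_polyE horner_along /translate /comp_mpoly; apply: eq_mmap => // i.
by rewrite tnth_mktuple mpolyCM.
Qed.

Lemma meval_translate q F x : (translate q F).@[x] = F.@[fun i => x i + q i].
Proof.
rewrite /translate comp_mpoly_meval; apply: meval_eq => i.
by rewrite tnth_mktuple mevalD mevalXU mevalC.
Qed.

Lemma translateM q F G : translate q (F * G) = translate q F * translate q G.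
Proof. exact: rmorphM. Qed.

Lemma line_polyM p F G : line_poly p (F * G) = line_poly p F * line_poly p G.
Proof. by rewrite !line_polyE; exact: rmorphM. Qed.

Lemma line_polyD p F G : line_poly p (F + G) = line_poly p F + line_poly p G.
Proof. by rewrite !line_polyE; exact: rmorphD. Qed.

Lemma lead_line_poly p F d : (msize F <= d.+1)%N -> (pihomog mdeg d F).@[p] != 0 ->
  lead_coef (line_poly p F) = ((pihomog mdeg d F).@[p])%:MP.
Proof.
move=> /(top_coef_line_poly p) [sz cd] h; rewrite lead_coefE.
suff -> : size (line_poly p F) = d.+1 by [].
apply/eqP; rewrite eqn_leq sz /= ltnNge; apply/negP => sz'.
by move: cd; rewrite nth_default // => /esym/eqP; rewrite mpolyC_eq0 (negPf h).
Qed.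

Lemma unit_lead_line_poly p F d : (msize F <= d.+1)%N -> (pihomog mdeg d F).@[p] != 0 ->
  lead_coef (line_poly p F) \is a GRing.unit.
Proof.
move=> hF h; rewrite (lead_line_poly hF h).
by apply/unitrP; exists ((pihomog mdeg d F).@[p]^-1)%:MP; rewrite -!mpolyCM mulVf // divff.
Qed.

Lemma msize_homog d F : F \is d.-homog -> (msize F <= d.+1)%N.
Proof.
by move=> hF; rewrite msizeE; apply/bigmax_leqP_seq => m mF _; rewrite (dhomog_mf hF mF).
Qed.

(** Over an algebraically closed field, N = 0 is the union of the lines parallel to [p] that meet F
    = G = 0. *)
Lemma line_elimination d p F G : (msize F <= d.+1)%N -> (pihomog mdeg d F).@[p] != 0 ->
  exists (N : {mpoly K[n]}) u v, N%:P = u * line_poly p F + v * line_poly p G /\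
    forall x, (N.@[x] != 0) = coprimep (on_line x p F) (on_line x p G).
Proof.
move=> hF h; have uf := unit_lead_line_poly hF h.
have f0 : line_poly p F != 0 by apply: contraTneq uf => ->; rewrite lead_coef0 unitr0.
have [N [u [v [EN hN]]]] := elimination (line_poly p G) f0.
exists N, u, v; split=> // x.
have := hN K (meval x : {rmorphism {mpoly K[n]} -> K}).
move: (map_line_poly x p F) (map_line_poly x p G) (lead_line_poly hF h).
move: (line_poly p F) (line_poly p G) => lF lG EF EG EL.
by rewrite EL EF EG /= mevalC h => /(_ isT).
Qed.

(** One line without common zeros makes the elimination polynomial [N] nonzero. Since [N] is a
    multiple of G(X + T p) modulo F(X + T p), and nonzero constants are regular there, so is G(X + T
    p); setting T = 0 returns to the original ring. *)
Lemma regular_on_line d p x F G : (msize F <= d.+1)%N -> (pihomog mdeg d F).@[p] != 0 ->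
  coprimep (on_line x p F) (on_line x p G) -> regular_pair G F.
Proof.
move=> hF h cop y w E; have [N [u [v [EN hN]]]] := line_elimination G hF h.
have N0 : N != 0.
  by move: cop; rewrite -hN; apply: contraNneq => ->; rewrite meval0.
have EN' : N%:P * line_poly p y = (u * line_poly p y + v * line_poly p w) * line_poly p F.
  have EM : line_poly p G * line_poly p y = line_poly p F * line_poly p w.
    by rewrite -!line_polyM E.
  move: EM EN; move: (line_poly p F) (line_poly p G) (line_poly p y) (line_poly p w).
  move=> a b c e EM ->; transitivity (u * a * c + v * (b * c)); first by ring.
  by rewrite EM; ring.
have [s Es] := const_regular (unit_lead_line_poly hF h) N0 EN'.
exists s.[0]; have /(congr1 (horner^~ 0)) := Es.
by rewrite hornerM !line_poly0 mulrC.
Qed.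

End Lines.

(** * Regularity of (P, Q) and test points on Z *)

Section RegularityOfZ.
Context (K : closedFieldType) (n : nat).
Hypothesis uK : uncountable K.
Implicit Types (P Q : {mpoly K[n.+1]}).

Lemma homog_point d (F : {mpoly K[n.+1]}) z : (0 < d)%N -> F \is d.-homog ->
  F.@[z] != 0 -> is_point z.
Proof.
move=> d0 hF /negP Fz; apply: contrapT => /forallNP hz; apply: Fz.
rewrite mevalE big_seq big1 // => m mF.
have md : mdeg m = d := dhomog_mf hF mF.
have [i mi] : exists i, m i != 0%N.
  apply: contrapT => /forallNP h; move: d0; rewrite -md mdegE big1 // => i _.
  by apply/eqP; apply: contrapT => /negP/h.
have /negP/negPn/eqP zi := hz i.
by rewrite (bigD1 i) //= zi expr0n (negPf mi) mul0r mulr0.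
Qed.

Lemma translateK q (F : {mpoly K[n.+1]}) : translate (fun i => - q i) (translate q F) = F.
Proof.
apply/eqP; rewrite -subr_eq0; apply/eqP; apply: contrapT => /eqP /(mpoly_nonvanishing uK) [z].
rewrite mevalB !meval_translate => /eqP; apply; apply/eqP; rewrite subr_eq0; apply/eqP.
by apply: meval_eq => i; rewrite addrNK.
Qed.

Lemma horner_meval (q : {poly {mpoly K[n.+1]}}) x t :
  (q.[t%:MP]).@[x] = (map_poly (meval x) q).[t].
Proof. by rewrite -{2}(mevalC x t) horner_map. Qed.

(* If every line parallel to p met Z, then P(x + T p) and Q(x + T p) would have a common
   factor G over K(x); at a general zero of G the relation (P / G) Q = (Q / G) P makes
   the differentials of P and Q dependent. *)
Lemma smooth_line k e P Q : (0 < n)%N -> (0 < k)%N -> smooth_complete_intersection k e P Q ->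
  exists p x, P.@[p] != 0 /\ coprimep (on_line x p P) (on_line x p Q).
Proof.
move=> n0 k0 [[P0 hP] _ smooth]; have [p Pp] := mpoly_nonvanishing uK P0.
exists p; apply: contrapT => /forallNP hx.
have {}hx x : ~ coprimep (on_line x p P) (on_line x p Q) by move=> c; apply: (hx x).
have [j pj] := homog_point k0 hP Pp.
have [i ij] : exists i : 'I_n.+1, i != j.
  have [->|j0] := eqVneq j ord0; last by exists ord0; rewrite eq_sym.
  by exists (inord 1); rewrite -val_eqE /= inordK.
set lF := line_poly p P in hx *; set lG := line_poly p Q in hx.
have mF x : map_poly (meval x) lF = on_line x p P by apply: map_line_poly.
have mG x : map_poly (meval x) lG = on_line x p Q by apply: map_line_poly.
have F0 : lF != 0.
  have := @unit_lead_line_poly _ _ p P k (msize_homog hP).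
  rewrite pihomog_dE // -/lF => /(_ Pp); apply: contraTneq => ->.
  by rewrite lead_coef0 unitr0.
(* Coprimality over the fraction field gives a Bezout relation with a nonzero constant [c'] of K[X];
   it specialises to coprimality on the line through any x with c'(x) != 0. *)
have ncop : ~~ coprimep lF lG.
  apply/negP => /Bezout_coprimepP [[u v] /= /eqpP [[c c'] /= /andP[c0 c'0] E]].
  have [x hc] := mpoly_nonvanishing uK c'0.
  apply: (hx x); apply/Bezout_eq1_coprimepP.
  exists (c'.@[x]^-1 *: map_poly (meval x) (c *: u), c'.@[x]^-1 *: map_poly (meval x) (c *: v)) => /=.
  rewrite -mF -mG -!scalerAl -scalerDr -!rmorphM -rmorphD /= -!scalerAl -scalerDr E.
  by rewrite alg_polyC map_polyC /= scale_polyC mulVf.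
pose G := gcdp lF lG.
have G0 : G != 0 by rewrite gcdp_eq0 negb_and F0.
have sG : (1 < size G)%N.
  by move: ncop; rewrite /coprimep -/G; rewrite -size_poly_gt0 in G0; case: (size G) G0 => [|[]].
have := coprimep_div_gcd (p := lF) (q := lG); rewrite F0 => /(_ isT).
have := dvdp_gcdl lF lG; rewrite Pdiv.Idomain.dvdp_eq => /eqP.
have := dvdp_gcdr lF lG; rewrite Pdiv.Idomain.dvdp_eq => /eqP; rewrite -/G.
set a := lF %/ G; set b := lG %/ G; set c2 := _ ^+ _; set c1 := _ ^+ _ => Eb Ea.
have c10 : c1 != 0 by rewrite expf_neq0 // lead_coef_eq0.
have c20 : c2 != 0 by rewrite expf_neq0 // lead_coef_eq0.
move=> /Bezout_coprimepP [[u v] /= /eqpP [[c c'] /= /andP[c0 c'0] E]].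
(* If w(x) != 0 then x is not proportional to [p], so the line through x misses the origin and its
   points are points of projective space. *)
pose w := 'X_i * (p j)%:MP - 'X_j * (p i)%:MP : {mpoly K[n.+1]}.
have w0 : w != 0.
  apply/eqP => /(congr1 (meval (fun l => (l == i)%:R))); rewrite meval0 mevalB !mevalM !mevalC !mevalXU.
  by rewrite eqxx eq_sym (negPf ij) mul1r mul0r subr0 => /eqP; rewrite (negPf pj).
have [x] : exists x, (c1 * c2 * c' * lead_coef G * w).@[x] != 0.
  by apply: (mpoly_nonvanishing uK); rewrite !mulf_neq0 // lead_coef_eq0.
rewrite !mevalM !mulf_eq0 !negb_or -!andbA => /and5P[c1x c2x c'x Gx wx].
have [t rt] : exists t, root (map_poly (meval x) G) t.
  apply/closed_rootP; rewrite (_ : size _ = size G); first by rewrite neq_ltn sG orbT.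
  by rewrite size_map_poly_id0.
pose z i := x i + t * p i.
have zE F : F.@[z] = (on_line x p F).[t] by rewrite horner_on_line.
have Pz : P.@[z] = 0.
  have /(congr1 (fun q => (map_poly (meval x) q).[t])) := Ea.
  rewrite rmorphM hornerM (rootP rt) mulr0 -mul_polyC rmorphM hornerM /= map_polyC hornerC mF zE.
  by move/eqP; rewrite mulf_eq0 (negPf c1x) => /eqP.
have Qz : Q.@[z] = 0.
  have /(congr1 (fun q => (map_poly (meval x) q).[t])) := Eb.
  rewrite rmorphM hornerM (rootP rt) mulr0 -mul_polyC rmorphM hornerM /= map_polyC hornerC mG zE.
  by move/eqP; rewrite mulf_eq0 (negPf c2x) => /eqP.
have ptz : is_point z.
  apply: contrapT => /forallNP hz; move: wx; apply/negP; rewrite negbK.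
  have xE l : x l = - (t * p l).
    by apply/eqP; rewrite -addr_eq0; apply: contrapT => /negP/hz.
  by rewrite /w mevalB !mevalM !mevalXU !mevalC !xE; apply/eqP; ring.
have := smooth z ptz Pz Qz.
have rel : (c1 *: b) * lF = (c2 *: a) * lG.
  transitivity (b * (c1 *: lF)); first by rewrite -scalerAl scalerAr.
  transitivity (a * (c2 *: lG)); last by rewrite -scalerAr scalerAl.
  by rewrite Ea Eb mulrCA.
(* Setting T = t in [rel] and translating back by - t p gives a relation U P = V Q in K[X] itself,
   with U(z) and V(z) the values of c1 b and c2 a at (x, t). *)
pose tr := translate (fun i => - (t * p i)) : {mpoly K[n.+1]} -> {mpoly K[n.+1]}.
have rel' : tr (c1 *: b).[t%:MP] * P = tr (c2 *: a).[t%:MP] * Q.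
  have /(congr1 (fun q => tr q.[t%:MP])) := rel; rewrite /tr !hornerM !horner_line_poly.
  by rewrite !translateM !translateK.
have trz g : (tr g.[t%:MP]).@[z] = (map_poly (meval x) g).[t].
  by rewrite meval_translate -horner_meval; apply: meval_eq => l; rewrite addrK.
move: (trz (c1 *: b)) (trz (c2 *: a)) rel'.
move: (tr (c1 *: b).[t%:MP]) (tr (c2 *: a).[t%:MP]) => U V EU EV rel'.
(* Differentiating U P = V Q at z gives U(z) dP = V(z) dQ, so smoothness forces U(z) = V(z) = 0.
   Then the cofactors [a] and [b] have a common zero, against their Bezout relation and c'(x) !=
   0. *)
move=> /mulmx_free_eq0 - /(_ _ (row_mx U.@[z]%:M (- V.@[z])%:M)).
rewrite mul_row_col !mul_scalar_mx.
have -> : U.@[z] *: (\row_i0 (P^`M(i0)).@[z]) + - V.@[z] *: (\row_i0 (Q^`M(i0)).@[z]) = 0.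
  apply/rowP => l; rewrite !mxE mulNr.
  have /(congr1 (fun F => (F^`M(l)).@[z])) := rel'.
  rewrite !mderivM !mevalD !mevalM Pz Qz !mulr0 !add0r => ->.
  by rewrite subrr.
rewrite eqxx => /esym/eqP; rewrite -row_mx0 => /eq_row_mx [U0 V0].
have {}U0 : U.@[z] = 0 by move/matrixP: U0 => /(_ 0 0); rewrite !mxE eqxx mulr1n.
have {}V0 : V.@[z] = 0.
  by move/matrixP: V0 => /(_ 0 0); rewrite !mxE eqxx mulr1n => /eqP; rewrite oppr_eq0 => /eqP.
move: EU EV; rewrite U0 V0 -!mul_polyC !rmorphM !hornerM /= !map_polyC !hornerC.
move/esym/eqP; rewrite mulf_eq0 (negPf c1x) => /eqP bx.
move/esym/eqP; rewrite mulf_eq0 (negPf c2x) => /eqP ax.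
have /(congr1 (fun q => (map_poly (meval x) q).[t])) := E.
rewrite alg_polyC -mul_polyC rmorphM rmorphD !rmorphM /= !map_polyC !hornerE ax bx.
by rewrite !mulr0 addr0 mulr0 => /esym/eqP; rewrite (negPf c'x).
Qed.

End RegularityOfZ.

Lemma root_list (K : closedFieldType) (p : {poly K}) :
  p != 0 -> {r : seq K | forall x, root p x = (x \in r)}.
Proof.
move=> p0; have [r E] := closed_field_poly_normal p; exists r => x.
by rewrite E rootZ ?lead_coef_eq0 // root_prod_XsubC.
Qed.

Section TestPoints.
Context (K : closedFieldType) (n : nat).
Hypothesis uK : uncountable K.
Implicit Types (P Q c y : {mpoly K[n.+1]}).

(** Two vectors in a space of dimension at least 3 are killed by a nonzero linear form [v]; [r] is a
    basis vector on which [v] does not vanish, so [v] is a nonzero constant on the affine plane. *)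
Lemma off_plane (p q : 'I_n.+1 -> K) : (2 <= n)%N ->
  exists r : 'I_n.+1 -> K, forall s t, is_point (fun i => r i + s * q i + t * p i).
Proof.
move=> n2; pose M : 'M[K]_(n.+1, 2) := \matrix_(i, j) if j == 0 then p i else q i.
have : kermx M != 0.
  rewrite kermx_eq0 /row_free; apply/eqP => E.
  by have := rank_leq_col M; rewrite E; lia.
case/rowV0Pn => v /sub_kermxP vM /rV0Pn [i vi].
have vp : \sum_j v 0 j * p j = 0.
  by have /rowP/(_ 0) := vM; rewrite !mxE => E; rewrite -[RHS]E; apply: eq_bigr => j _; rewrite mxE.
have vq : \sum_j v 0 j * q j = 0.
  by have /rowP/(_ 1) := vM; rewrite !mxE => E; rewrite -[RHS]E; apply: eq_bigr => j _; rewrite mxE.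
exists (fun j => (j == i)%:R) => s t; apply: contrapT => /forallNP h.
move: vi; apply/negP; rewrite negbK.
have -> : v 0 i = \sum_j v 0 j * ((j == i)%:R + s * q j + t * p j).
  under eq_bigr do rewrite !mulrDr [_ * (s * _)]mulrCA [_ * (t * _)]mulrCA.
  rewrite !big_split /= -!mulr_sumr vp vq !mulr0 !addr0 (bigD1 i) //= eqxx mulr1.
  by rewrite big1 ?addr0 // => j /negPf ->; rewrite mulr0.
rewrite big1 // => j _; have /negP := h j; rewrite negbK => /eqP ->.
by rewrite mulr0.
Qed.

(* The points over the zeros on a line of the elimination polynomial rho of (P, Q). *)
Lemma test_points k p x0 P Q : (2 <= n)%N -> P \is k.-homog -> P.@[p] != 0 ->
  coprimep (on_line x0 p P) (on_line x0 p Q) ->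
  exists zs : seq {ffun 'I_n.+1 -> K},
    {in zs, forall z : {ffun 'I_n.+1 -> K}, is_point z /\ P.@[z] = 0} /\
    forall c, {in zs, forall z : {ffun 'I_n.+1 -> K}, c.@[z] != 0} ->
      forall y, in_ideal [:: P; Q] (c * y) -> in_ideal [:: P; Q] y.
Proof.
move=> n2 hP Pp cop.
have hPk := msize_homog hP; have Ppk : (pihomog mdeg k P).@[p] != 0 by rewrite pihomog_dE.
have [rho [u [v [Erho hrho]]]] := line_elimination Q hPk Ppk.
have rho0 : rho != 0 by move: cop; rewrite -hrho; apply: contraNneq => ->; rewrite meval0.
pose D := (msize rho).-1.
have hD : (msize rho <= D.+1)%N by rewrite /D; case: (msize rho).
(* A direction in which the top form of [rho] is nonzero, so that [rho] has finitely many zeros on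
   every line parallel to [q]. *)
have [q hq] : exists q, (pihomog mdeg D rho).@[q] != 0.
  apply: (mpoly_nonvanishing uK); apply/eqP => h.
  have /eqP := congr1 (mcoeff (mlead rho)) h; apply/negP.
  rewrite mcoeff0 pihomogE big_mkcond raddf_sum /=.
  rewrite (bigD1_seq (mlead rho)) ?mlead_supp ?msupp_uniq //=.
  have -> : mdeg (mlead rho) == D by rewrite /D -mlead_deg.
  rewrite mcoeffZ mcoeffX eqxx mulr1 big1 ?addr0 ?mleadc_eq0 // => m /negPf hm.
  by case: ifP => _; rewrite ?mcoeff0 // mcoeffZ mcoeffX hm mulr0.
have [r hr] := off_plane p q n2.
have line0 (x s : 'I_n.+1 -> K) d (F : {mpoly K[n.+1]}) : (msize F <= d.+1)%N -> (pihomog mdeg d F).@[s] != 0 -> on_line x s F != 0.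
  move=> /(top_coef_on_line x s) [_ <-]; apply: contraNneq => ->; by rewrite coef0.
have [rs hrs] := root_list (line0 r q _ _ hD hq).
pose base s i := r i + s * q i.
pose rt s := sval (root_list (line0 (base s) p _ _ hPk Ppk)).
have hrt s t : (t \in rt s) = root (on_line (base s) p P) t.
  by rewrite /rt; case: root_list => l /= ->.
exists [seq [ffun i => base s i + t * p i] | s <- rs, t <- rt s]; split.
  move=> z /allpairsPdep [s [t [_ ht ->]]]; split.
    by have [i hi] := hr s t; exists i; rewrite ffunE.
  move: ht; rewrite hrt /root horner_on_line => /eqP <-.
  by apply: meval_eq => i; rewrite ffunE.
move=> c hc y /in_ideal2 [a [b E]].
have [N [u' [v' [EN hN]]]] := line_elimination c hPk Ppk.
(* The listed points are all zeros of [P] on the lines parallel to [p] through the zeros of [rho] on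
   one fixed line, hence do not depend on [c]. If [c] vanishes at none of them, [N] is nonzero at
   those zeros of [rho], and one line suffices for the regularity. *)
have reg : regular_pair N rho.
  apply: (regular_on_line (x := r) hD hq); apply/Pdiv.ClosedField.coprimepP => s rs_s.
  rewrite horner_on_line -/(base s) hN; apply/Pdiv.ClosedField.coprimepP => t rt_t.
  rewrite horner_on_line; have := hc [ffun i => base s i + t * p i].
  rewrite (meval_eq (v2 := fun i => base s i + t * p i)); last by move=> i; rewrite ffunE.
  by apply; apply: allpairs_f_dep; rewrite ?hrt // -hrs.
have El : line_poly p c * line_poly p y = line_poly p a * line_poly p P + line_poly p b * line_poly p Q.
  by rewrite -!line_polyM -line_polyD E.
have [s [t Est]] := triple_regular (unit_lead_line_poly hPk Ppk) rho0 Erho EN reg El.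
apply/in_ideal2; exists s.[0], t.[0].
have /(congr1 (horner^~ 0)) := Est.
by rewrite hornerD !hornerM !line_poly0.
Qed.

End TestPoints.

(** * Prime forms *)

Definition prime_elt (A : comPzRingType) (c : A) :=
  forall u v, (exists h, u * v = h * c) -> (exists h, u = h * c) \/ (exists h, v = h * c).

Local Notation tofrac := (@FracField.tofrac _).

(* R/(c) embeds in the fraction field of R through u |-> (L u) (- c / b). *)
Lemma graph_prime (R : idomainType) (L : R -> {poly R}) (c b : R) :
  (forall u v, L (u * v) = L u * L v) -> (forall u, (L u).[0] = u) ->
  L c = c%:P + b *: 'X -> b != 0 -> regular_pair b c -> prime_elt c.
Proof.
move=> LM L0 Lc b0 reg u v [h E].
have bF : tofrac b != 0 by rewrite tofrac_eq0.
pose psi u := (map_poly tofrac (L u)).[tofrac (- c) / tofrac b].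
have psiM x y : psi (x * y) = psi x * psi y by rewrite /psi LM rmorphM hornerM.
have psic : psi c = 0.
  rewrite /psi Lc rmorphD /= map_polyC map_polyZ map_polyX !hornerE /=.
  by rewrite [tofrac b * _]mulrC mulfK // rmorphN subrr.
have regX m f : (exists g, b ^+ m * f = g * c) -> exists g, f = g * c.
  elim: m => [|m IH]; first by rewrite mul1r.
  move=> [g]; rewrite exprS -mulrA mulrC [_ * c]mulrC => Eg; apply: IH.
  by have [g' ->] := reg _ _ (etrans (mulrC _ _) Eg); exists g'; rewrite mulrC.
have psi0 x : psi x = 0 -> exists g, x = g * c.
  (* Clearing denominators in psi(x) = 0 by b^m leaves a sum in which every term but b^m x is
     divisible by [c]; regularity then cancels the powers of [b]. *)
  move=> px; pose m := size (L x); apply: (regX m).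
  have key : \sum_(i < m) (L x)`_i * ((- c) ^+ i * b ^+ (m - i)) = 0.
    apply/eqP; rewrite -(@tofrac_eq0 R) rmorph_sum /=; apply/eqP.
    transitivity ((tofrac b) ^+ m * psi x); last by rewrite px mulr0.
    rewrite /psi horner_coef size_map_inj_poly ?rmorph0 //; last by move=> z1 z2 /eqP; rewrite tofrac_eq => /eqP.
    rewrite mulr_sumr; apply: eq_bigr => i _; rewrite coef_map /= !rmorphM !rmorphXn.
    rewrite exprMn exprVn [RHS]mulrCA; congr (_ * _).
    rewrite [RHS]mulrCA; congr (_ * _).
    by rewrite expfB_cond // (negPf bF) add0n ltnW.
  case Em : m key => [|m'] key.
    move: Em => /eqP; rewrite size_poly_eq0 => /eqP Lx0.
    by exists 0; rewrite -(L0 x) Lx0 horner0 mulr0 mul0r.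
  move: key; rewrite big_ord_recl /= expr0 mul1r subn0 -horner_coef0 L0 => key.
  exists (\sum_(i < m') (L x)`_i.+1 * ((- c) ^+ i * b ^+ (m'.+1 - i.+1))).
  apply/eqP; rewrite mulrC -subr_eq0 -[X in _ == X]key eq_sym; apply/eqP; congr (_ + _).
  rewrite mulr_suml -sumrN; apply: eq_bigr => i _; rewrite /bump /= add1n.
  by rewrite (exprS (- c)); ring.
have : psi u * psi v = 0 by rewrite -psiM E psiM psic mulr0.
by move/eqP; rewrite mulf_eq0 => /orP[]/eqP/psi0; [left|right].
Qed.

Section PrimeForm.
Context (K : closedFieldType) (n : nat).
Hypothesis uK : uncountable K.
Implicit Types (h z p : 'I_n.+1 -> K).

Definition linear_form h : {mpoly K[n.+1]} := \sum_i h i *: 'X_i.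

Lemma meval_linear_form h z : (linear_form h).@[z] = \sum_i h i * z i.
Proof.
by rewrite /linear_form raddf_sum /=; apply: eq_bigr => i _; rewrite mevalZ mevalXU.
Qed.

Lemma linear_form_homog h : linear_form h \is 1.-homog.
Proof. by apply: rpred_sum => i _; apply: rpredZ; rewrite dhomogX; apply/eqP; apply: mdeg1. Qed.

Lemma line_polyC p c : line_poly p (c%:MP : {mpoly K[n.+1]}) = (c%:MP)%:P.
Proof. by rewrite line_polyE /along mmapC. Qed.

Lemma line_polyX p i : line_poly p ('X_i : {mpoly K[n.+1]}) = ('X_i)%:P + (p i)%:MP *: 'X.
Proof. by rewrite line_polyE /along mmapX mmap1U. Qed.

Lemma line_poly_sum p (I : Type) (r : seq I) (F : I -> {mpoly K[n.+1]}) :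
  line_poly p (\sum_(i <- r) F i) = \sum_(i <- r) line_poly p (F i).
Proof. rewrite line_polyE rmorph_sum; apply: eq_bigr => i _; exact/esym/line_polyE. Qed.

Lemma line_polyXn p F e : line_poly p (F ^+ e : {mpoly K[n.+1]}) = line_poly p F ^+ e.
Proof. by rewrite !line_polyE rmorphXn. Qed.

Lemma line_poly_linear_form p h :
  line_poly p (linear_form h) = (linear_form h)%:P + ((linear_form h).@[p])%:MP *: 'X.
Proof.
rewrite /linear_form line_poly_sum raddf_sum /= meval_linear_form rmorph_sum scaler_suml -big_split /=.
apply: eq_bigr => i _; rewrite -mul_mpolyC line_polyM line_polyC line_polyX.
by rewrite polyCM mpolyCM -scalerA mulrDr !mul_polyC.
Qed.

Definition pencil_form h (i0 i1 : 'I_n.+1) e t : {mpoly K[n.+1]} :=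
  linear_form h ^+ e.+1 + t%:MP * ('X_i0 ^+ e * 'X_i1).

(** The vector [p] = e_i1 - (h_i1 / h_j) e_j kills the linear form and has p_i0 = 0 and p_i1 = 1.
    Along [p] the form is therefore of degree one in T, with slope t X_i0^e, and [graph_prime]
    applies. *)
Lemma pencil_form_prime h j i0 i1 e t : h j != 0 -> i0 != j -> i1 != j -> i0 != i1 ->
  (0 < e)%N -> t != 0 -> prime_elt (pencil_form h i0 i1 e t).
Proof.
move=> hj i0j i1j i01 e0 t0; set c := pencil_form _ _ _ _ _.
pose p i : K := (i == i1)%:R - (i == j)%:R * (h i1 / h j).
have pi0 : p i0 = 0 by rewrite /p (negPf i01) (negPf i0j) mul0r subrr.
have pi1 : p i1 = 1 by rewrite /p eqxx (negPf i1j) mul0r subr0.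
have hp : (linear_form h).@[p] = 0.
  rewrite meval_linear_form (bigD1 i1) //= (bigD1 j) 1?eq_sym //= big1 => [|i /andP[i1' ji]].
    by rewrite pi1 /p eqxx eq_sym (negPf i1j) sub0r mul1r mulr1 addr0 mulrN mulrCA divff // mulr1 subrr.
  by rewrite /p (negPf i1') (negPf ji) mul0r subrr mulr0.
have X0 i : 'X_i != 0 :> {mpoly K[n.+1]} by apply: mpolyX_neq0.
apply: (@graph_prime _ (line_poly p) c (t%:MP * 'X_i0 ^+ e)).
- by move=> u v; rewrite line_polyM.
- by move=> u; rewrite line_poly0.
- rewrite /c /pencil_form line_polyD line_polyXn line_poly_linear_form hp mpolyC0 scale0r addr0.
  rewrite !line_polyM line_polyC line_polyXn !line_polyX pi0 pi1 mpolyC0 mpolyC1 scale0r addr0 scale1r.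
  by rewrite -mul_polyC !polyCM !rmorphD !rmorphXn !rmorphM !rmorphXn /=; ring.
- by rewrite mulf_neq0 ?expf_neq0 // mpolyC_eq0.
(* Modulo X_i0 only the power of the linear form remains, and it is nonzero because its coefficient
   h_j survives. So [c] is prime to X_i0. *)
have kc : kill_var i0 c != 0.
  rewrite /c /pencil_form kill_varD !kill_varM /kill_var !rmorphXn /= -!/(kill_var _ _).
  rewrite kill_varX eqxx expr0n (gtn_eqF e0) mul0r mulr0 addr0 expf_neq0 //.
  apply/eqP => /(congr1 (meval (fun i => (i == j)%:R))); rewrite meval0 comp_mpoly_meval.
  rewrite meval_linear_form (bigD1 j) //= big1 => [|i ij].
    rewrite tnth_mktuple eq_sym (negPf i0j) mevalXU eqxx mulr1 addr0 => /eqP.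
    by rewrite (negPf hj).
  by rewrite tnth_mktuple; case: eqP => _; rewrite ?meval0 ?mevalXU ?(negPf ij) mulr0.
have cX m f : (exists g, 'X_i0 ^+ m * f = c * g) -> exists g, f = c * g.
  elim: m => [|m IH]; first by rewrite mul1r.
  move=> [g]; rewrite exprS -mulrA => E; apply: IH.
  have : kill_var i0 g = 0.
    have /(congr1 (kill_var i0)) := E; rewrite !kill_varM kill_varX eqxx mul0r.
    by move/esym/eqP; rewrite mulf_eq0 (negPf kc) => /eqP.
  move=> /kill_var_dvd [g' Eg]; exists g'; apply: (mulfI (X0 i0)); rewrite E Eg; ring.
move=> f g E; apply: (cX e); exists ((t^-1)%:MP * g).
rewrite mulrCA -E mulrA mulrA -mpolyCM mulVf // mpolyC1 mul1r //.
Qed.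

(** A general linear form [g] is corrected by a multiple of X_j so as to vanish at [y]. Its value at
    z becomes that of [g] at the projection of z from [y] to the hyperplane X_j = 0, which is
    nonzero for general [g]. *)
Lemma general_linear_form (y : 'I_n.+1 -> K) j (zs : seq {ffun 'I_n.+1 -> K}) : y j != 0 ->
  {in zs, forall z : {ffun 'I_n.+1 -> K}, is_point (fun i => z i - z j / y j * y i)} ->
  exists h, (linear_form h).@[y] = 0 /\
    {in zs, forall z : {ffun 'I_n.+1 -> K}, (linear_form h).@[z] != 0}.
Proof.
move=> yj hzs.
pose w (z : {ffun 'I_n.+1 -> K}) i := z i - z j / y j * y i.
have prod0 : \prod_(z <- zs) linear_form (w z) != 0.
  rewrite prodf_seq_neq0; apply/allP => z zzs /=.
  have [i wi] := hzs z zzs; apply/eqP => /(congr1 (meval (fun l => (l == i)%:R))).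
  rewrite meval0 meval_linear_form (bigD1 i) //= big1 => [|l /negPf li].
    by rewrite eqxx mulr1 addr0 => /eqP; rewrite (negPf wi).
  by rewrite li mulr0.
have [g hg] := mpoly_nonvanishing uK prod0.
have sum_corr a (z : 'I_n.+1 -> K) :
    (linear_form (fun i => g i - (i == j)%:R * a)).@[z] = \sum_i g i * z i - a * z j.
  rewrite meval_linear_form; under eq_bigr do rewrite mulrBl.
  rewrite sumrB; congr (_ - _); rewrite (bigD1 j) //= big1 ?addr0 ?eqxx ?mul1r // => i /negPf ->.
  by rewrite !mul0r.
exists (fun i => g i - (i == j)%:R * ((\sum_l g l * y l) / y j)); split.
  by rewrite sum_corr divfK // subrr.
move=> z zzs; rewrite sum_corr.
have : (linear_form (w z)).@[g] != 0.
  move: hg; rewrite rmorph_prod /= prodf_seq_neq0 => /allP /(_ z zzs); exact.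
rewrite meval_linear_form; congr (_ != 0).
transitivity (\sum_i (g i * z i - z j / y j * (g i * y i))).
  by apply: eq_bigr => i _; rewrite /w; ring.
by rewrite sumrB -mulr_sumr; congr (_ - _); rewrite mulrC mulrAC mulrA.
Qed.

Lemma avoid_finite (I : eqType) (s : seq I) (a b : I -> K) : {in s, forall i, a i != 0} ->
  exists2 t, t != 0 & {in s, forall i, a i + t * b i != 0}.
Proof.
move=> ha.
have p0 : 'X * \prod_(i <- s) ((a i)%:P + b i *: 'X) != 0.
  rewrite mulf_neq0 ?polyX_eq0 // prodf_seq_neq0; apply/allP => i si /=.
  apply: contraNneq (ha i si) => /(congr1 (horner^~ 0)).
  by rewrite !hornerE => /eqP.
have [t] := closed_nonrootP _ p0.
rewrite rootE hornerM hornerX mulf_eq0 negb_or horner_prod prodf_seq_neq0 => /andP[t0 /allP ht].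
by exists t => // i /ht; rewrite /= !hornerE mulrC.
Qed.

(** Besides primality, [c] must avoid finitely many zeros: the points [zs], the direction [b], and
    the zeros of [P] on the line y + T b. The power of h avoids them all: h(y + t b) = t h(b), and t
    != 0 where [P] vanishes since P(y) != 0. A suitable t != 0 in the pencil keeps this and adds
    primality. *)
Lemma exists_prime_form e P k (zs : seq {ffun 'I_n.+1 -> K}) : (2 <= n)%N -> (0 < e)%N ->
  P \is k.-homog -> (0 < k)%N -> P != 0 ->
  {in zs, forall z : {ffun 'I_n.+1 -> K}, is_point z /\ P.@[z] = 0} ->
  exists c y p, [/\ c \is e.+1.-homog, prime_elt c,
    {in zs, forall z : {ffun 'I_n.+1 -> K}, c.@[z] != 0}, c.@[p] != 0 &
    coprimep (on_line y p c) (on_line y p P)].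
Proof.
move=> n2 e0 hP k0 P0 hzs.
have [y Py] := mpoly_nonvanishing uK P0.
have [j yj] := homog_point k0 hP Py.
have Pscale z a : (forall i, z i = a * y i) -> P.@[z] = a ^+ k * P.@[y].
  move=> hz; rewrite !mevalE mulr_sumr; apply: eq_big_seq => m mP.
  have md : mdeg m = k := dhomog_mf hP mP.
  under eq_bigr do rewrite hz exprMn.
  by rewrite big_split /= prodrXr -mdegE md mulrCA.
have indices (l : 'I_n.+1) : exists i0 i1 : 'I_n.+1, [/\ i0 != l, i1 != l & i0 != i1].
  have : (1 < #|predC1 l|)%N by rewrite cardC1 card_ord.
  by case/card_gt1P => i0 [i1 [h0 h1 h01]]; exists i0, i1.
have [i0 [_ [i0j _ _]]] := indices j.
pose b : {ffun 'I_n.+1 -> K} := [ffun i => (i == i0)%:R].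
have [|h [hy hz]] := @general_linear_form y j (b :: zs) yj.
  move=> z; rewrite inE => /predU1P[->|zzs].
    by exists i0; rewrite !ffunE eqxx [j == i0]eq_sym (negPf i0j) !mul0r subr0 oner_eq0.
  have [[i zi] Pz] := hzs z zzs; apply: contrapT => /forallNP hE.
  have zE l : z l = z j / y j * y l.
    by apply/eqP; rewrite -subr_eq0; apply: contrapT => /negP/hE.
  have := Pscale z _ zE; rewrite Pz => /esym/eqP.
  rewrite mulf_eq0 (negPf Py) orbF expf_eq0 k0 mulf_eq0 invr_eq0 (negPf yj) orbF => /eqP zj.
  by move: zi; rewrite zE zj !mul0r eqxx.
have hb : (linear_form h).@[b] != 0 by apply: hz; rewrite mem_head.
have {}hz : {in zs, forall z : {ffun 'I_n.+1 -> K}, (linear_form h).@[z] != 0}.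
  by move=> z zzs; apply: hz; rewrite inE zzs orbT.
have [l hl] : exists l, h l != 0.
  apply: contrapT => /forallNP h0; move: hb; apply/negP; rewrite negbK meval_linear_form.
  by rewrite big1 // => i _; have /negP/negPn/eqP -> := h0 i; rewrite mul0r.
have [i1 [i2 [i1l i2l i12]]] := indices l.
have hP' := msize_homog hP.
have lineP : on_line y b P != 0.
  by apply: contraNneq Py => E; rewrite -(meval_eq (v1 := fun i => y i + 0 * b i));
    [rewrite -horner_on_line E horner0|move=> i; rewrite mul0r addr0].
have [rs hrs] := root_list lineP.
pose zs' := zs ++ b :: [seq [ffun i => y i + t * b i] | t <- rs].
have hzs' : {in zs', forall z : {ffun 'I_n.+1 -> K}, (linear_form h).@[z] ^+ e.+1 != 0}.
  move=> z; rewrite mem_cat inE => zzs; apply: expf_neq0; move: zzs.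
  move=> /or3P[/hz //|/eqP -> //|/mapP[t trs ->]].
  have -> : (linear_form h).@[[ffun i => y i + t * b i]] = \sum_i (h i * y i + t * (h i * b i)).
    by rewrite meval_linear_form; apply: eq_bigr => i _; rewrite ffunE mulrDr (mulrCA (h i)).
  rewrite big_split /= -mulr_sumr -!meval_linear_form hy add0r mulf_neq0 //.
  move: trs; rewrite -hrs /root horner_on_line; apply: contraTneq => ->.
  by rewrite (meval_eq (v2 := y)) // => i; rewrite mul0r addr0.
have [t t0 ht] := @avoid_finite {ffun 'I_n.+1 -> K} zs'
  (fun z : {ffun 'I_n.+1 -> K} => (linear_form h).@[z] ^+ e.+1)
  (fun z : {ffun 'I_n.+1 -> K} => ('X_i1 ^+ e * 'X_i2 : {mpoly K[n.+1]}).@[z]) hzs'.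
have {}ht : {in zs', forall z : {ffun 'I_n.+1 -> K}, (pencil_form h i1 i2 e t).@[z] != 0}.
  by move=> z /ht E; rewrite /pencil_form mevalD rmorphXn /= [X in _ + X]mevalM mevalC.
have hX i : ('X_i : {mpoly K[n.+1]}) \is 1.-homog by rewrite dhomogX; apply/eqP; apply: mdeg1.
exists (pencil_form h i1 i2 e t), y, b; split.
- rewrite /pencil_form rpredD //.
    by have := dhomogMn e.+1 (linear_form_homog h); rewrite mul1n.
  rewrite mul_mpolyC rpredZ // (_ : e.+1 = 1 * e + 1)%N; last by rewrite mul1n addn1.
  apply: dhomogM; first exact: dhomogMn (hX i1).
  exact: hX.
- exact: pencil_form_prime hl _ _ _ _ _.
- by move=> z zzs; apply: ht; rewrite mem_cat zzs.
- by apply: ht; rewrite mem_cat mem_head orbT.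
rewrite coprimep_sym; apply/Pdiv.ClosedField.coprimepP => s; rewrite hrs => srs.
rewrite horner_on_line (meval_eq (v2 := [ffun i => y i + s * b i])); last by move=> i; rewrite ffunE.
by apply: ht; rewrite mem_cat inE map_f ?orbT.
Qed.

End PrimeForm.

(** * Openness of the uniqueness condition *)

Lemma dhomog_bigprod (n : nat) (R : nzRingType) (I : finType) (d : I -> nat)
    (F : I -> {mpoly R[n]}) : (forall i, F i \is (d i).-homog) ->
  \prod_i F i \is (\sum_i d i).-homog.
Proof.
move=> hF; elim/big_rec2: _ => [|i y1 y2 _ IH]; first exact: dhomog1.
exact: dhomogM.
Qed.

Lemma dhomog_det (n r : nat) (R : comNzRingType) (d : 'I_r -> nat) (A : 'M[{mpoly R[n]}]_r) :
  (forall i j, A i j \is (d i).-homog) -> \det A \is (\sum_i d i).-homog.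
Proof.
move=> hA; rewrite /determinant; apply: rpred_sum => s _; rewrite rpredMsign.
by apply: dhomog_bigprod.
Qed.

Lemma row_free_minor (K : fieldType) (r c : nat) (A : 'M[K]_(r, c)) :
  row_free A <-> exists f : {ffun 'I_r -> 'I_c}, \det (colsub f A) != 0.
Proof.
split=> [fA|[f hf]].
  have fA' : row_full A^T by rewrite /row_full mxrank_tr.
  exists [ffun i => fullrankfun fA' i].
  have -> : colsub [ffun i => fullrankfun fA' i] A = (rowsub (fullrankfun fA') A^T)^T.
    by apply/matrixP => i j; rewrite !mxE ffunE.
  rewrite det_tr -unitfE -unitmxE; exact: fullrowsub_unit.
have E : colsub f A = A *m colsub f 1%:M by rewrite mulmx_colsub mulmx1.
have u : colsub f A \in unitmx by rewrite unitmxE unitfE.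
by rewrite /row_free eqn_leq rank_leq_row /= -{1}(mxrank_unit u) E mxrankM_maxl.
Qed.

Lemma homog_sum (n N : nat) (R : nzRingType) (F : {mpoly R[n]}) : F \is N.-homog ->
  F = \sum_(m : {m : 'X_{1..n < N.+1} | mdeg m == N})
        F@_(bmnm (val m)) *: 'X_[bmnm (val m)].
Proof.
move=> hF; have hs : (msize F <= N.+1)%N.
  by rewrite msizeE; apply/bigmax_leqP_seq => m mF _; rewrite (dhomog_mf hF mF).
rewrite [LHS](mpolywE hs).
rewrite (bigID (fun m : 'X_{1..n < N.+1} => mdeg m == N)) /= [X in _ + X]big1 ?addr0.
  by rewrite [LHS]big_sub.
by move=> m /negPf mN; rewrite (dhomog_nemf_coeff hF) ?scale0r //= mN.
Qed.

Section AtParam.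
Context (K : fieldType) (M a : nat).

Lemma at_param_sig : {f : ('I_M -> K) -> {mpoly {mpoly K[M]}[a]} -> {mpoly K[a]} |
  forall y F, f y F = map_mpoly (meval y) F}.
Proof. by exists (fun y F => map_mpoly (meval y) F). Qed.

Lemma lift_param_sig : {f : {mpoly K[a]} -> {mpoly {mpoly K[M]}[a]} |
  forall F, f F = map_mpoly (@mpolyC M K) F}.
Proof. by exists (fun F => map_mpoly (@mpolyC M K) F). Qed.

(* Evaluation of the parameters, the variables being left free; sealed like on_line. *)
Definition at_param := sval at_param_sig.
Definition lift_param := sval lift_param_sig.

Lemma at_paramE y F : at_param y F = map_mpoly (meval y) F.
Proof. exact: (svalP at_param_sig). Qed.

Lemma lift_paramE F : lift_param F = map_mpoly (@mpolyC M K) F.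
Proof. exact: (svalP lift_param_sig). Qed.

Lemma mcoeff_at_param y F m : (at_param y F)@_m = (F@_m).@[y].
Proof. by rewrite at_paramE mcoeff_map_mpoly. Qed.

Lemma at_paramM y F G : at_param y (F * G) = at_param y F * at_param y G.
Proof. by rewrite !at_paramE rmorphM. Qed.

Lemma at_paramD y F G : at_param y (F + G) = at_param y F + at_param y G.
Proof. by rewrite !at_paramE rmorphD. Qed.

Lemma at_paramN y F : at_param y (- F) = - at_param y F.
Proof. by rewrite !at_paramE rmorphN. Qed.

Lemma at_param_sum y (I : finType) (F : I -> {mpoly {mpoly K[M]}[a]}) :
  at_param y (\sum_i F i) = \sum_i at_param y (F i).
Proof. by rewrite at_paramE rmorph_sum; apply: eq_bigr => i _; rewrite at_paramE. Qed.

Lemma at_paramC y c : at_param y c%:MP = (c.@[y])%:MP.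
Proof. by rewrite at_paramE map_mpolyC. Qed.

Lemma at_paramX y m : at_param y 'X_[m] = 'X_[m].
Proof. by rewrite at_paramE map_mpolyX. Qed.

Lemma at_param_lift y (F : {mpoly K[a]}) : at_param y (lift_param F) = F.
Proof. by apply/mpolyP => m; rewrite mcoeff_at_param lift_paramE mcoeff_map_mpoly /= mevalC. Qed.

Lemma lift_paramM F G : lift_param (F * G) = lift_param F * lift_param G.
Proof. by rewrite !lift_paramE rmorphM. Qed.

Lemma lift_param_homog d F : F \is d.-homog -> lift_param F \is d.-homog.
Proof.
move=> hF; apply/dhomogP => m; rewrite mcoeff_msupp lift_paramE mcoeff_map_mpoly mpolyC_eq0 -mcoeff_msupp.
exact: dhomog_mf hF m.
Qed.

Lemma at_param_homog y d F : F \is d.-homog -> at_param y F \is d.-homog.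
Proof.
move=> hF; apply/dhomogP => m; rewrite mcoeff_msupp mcoeff_at_param => h.
apply: (dhomog_mf hF); rewrite mcoeff_msupp; apply: contraNneq h => ->.
by rewrite raddf0.
Qed.

End AtParam.

Section Openness.
Context (K : closedFieldType) (M a : nat).
Hypothesis uK : uncountable K.

(* The proof perturbs an expression of all monomials of large degree in terms of the
   forms at y0: the perturbed coefficient matrix stays invertible near y0. *)
Lemma elimination_open (J : finType) (D : J -> {mpoly {mpoly K[M]}[a]}) delta y0 :
  (forall j, D j \is delta.-homog) ->
  (forall u : 'I_a -> K, (exists i, u i != 0) -> exists j, (at_param y0 (D j)).@[u] != 0) ->
  exists s : {mpoly K[M]}, s.@[y0] != 0 /\ forall y, s.@[y] != 0 ->
    forall u : 'I_a -> K, (exists i, u i != 0) -> exists j, (at_param y (D j)).@[u] != 0.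
Proof.
move=> hD h0.
pose I (f : {mpoly K[a]}) := exists g : J -> {mpoly K[a]}, f = \sum_j g j * at_param y0 (D j).
have Iid : is_ideal I.
  split.
  - by exists (fun=> 0); rewrite big1 // => j _; rewrite mul0r.
  - move=> f g [u ->] [v ->]; exists (fun j => u j + v j).
    by rewrite -big_split; apply: eq_bigr => j _; rewrite mulrDl.
  - move=> f g [u ->]; exists (fun j => f * u j).
    by rewrite mulr_sumr; apply: eq_bigr => j _; rewrite mulrA.
have /choice [e he] : forall i, exists m, I ('X_i ^+ m).
  move=> i; apply: (nullstellensatz uK Iid) => z hz; rewrite mevalXU.
  apply/eqP; apply: contrapT => /negP zi.
  have [j] := h0 z (ex_intro _ i zi); rewrite hz ?eqxx //.
  exists (fun j' => (j' == j)%:R); rewrite (bigD1 j) //= eqxx mul1r big1 ?addr0 // => j' /negPf ->.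
  by rewrite mul0r.
(* Large enough that every monomial of degree N lies in the ideal of the forms at [y0], and at least
   [delta], so that N - delta is a true degree. *)
pose N := (delta + (\sum_i e i).+1)%N.
pose T : finType := {m : 'X_{1..a < N.+1} | mdeg m == N}.
have /choice [g hg] : forall m : T, exists g : J -> {mpoly K[a]},
    (forall j, g j \is (N - delta).-homog) /\ 'X_[bmnm (val m)] = \sum_j g j * at_param y0 (D j).
  move=> m; have [g Eg] : I 'X_[bmnm (val m)].
    have [_ _ IM] := Iid; have /eqP mN := valP m.
    have [i ei] : exists i, (e i <= (val m : 'X_{1..a}) i)%N.
      apply: contrapT => /forallNP h.
      have : (mdeg (val m) <= \sum_i e i)%N.
        by rewrite mdegE; apply: leq_sum => i _; have /negP := h i; rewrite -ltnNge => /ltnW.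
      by rewrite mN /N; lia.
    have -> : (val m : 'X_{1..a}) = ((val m - U_(i) *+ e i) + U_(i) *+ e i)%MM.
      rewrite submK //; apply/mnm_lepP => j; rewrite mulmnE mnm1E.
      by case: eqP => [<-|_]; rewrite ?mul1n ?mul0n.
    by rewrite mpolyXD -mpolyXn; apply: IM.
  exists (fun j => pihomog mdeg (N - delta) (g j)); split=> [j|]; first exact: pihomogP.
  have hX : ('X_[bmnm (val m)] : {mpoly K[a]}) \is N.-homog by rewrite dhomogX; exact: (valP m).
  rewrite -[LHS](pihomog_dE hX) Eg raddf_sum; apply: eq_bigr => j _ /=.
  by rewrite -(pihomogM_homog _ _ (at_param_homog y0 (hD j))) subnK // /N leq_addr.
(* The cofactors found at [y0] are frozen while the forms vary with the parameters: at [y0] this is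
   the monomial [m], so the coefficient matrix [H] specialises to the identity. *)
pose E (m : T) : {mpoly {mpoly K[M]}[a]} := \sum_j lift_param M (g m j) * D j.
have EE y m : at_param y (E m) = \sum_j g m j * at_param y (D j).
  by rewrite at_param_sum; apply: eq_bigr => j _; rewrite at_paramM at_param_lift.
pose ev (i : 'I_#|T|) : T := enum_val i.
pose H : 'M[{mpoly K[M]}]_#|T| := \matrix_(i, j) (E (ev i))@_(bmnm (val (ev j))).
pose Hy y : 'M[K]_#|T| := \matrix_(i, j) (at_param y (E (ev i)))@_(bmnm (val (ev j))).
have HE y : map_mx (meval y) H = Hy y.
  by apply/matrixP => i j; rewrite !mxE mcoeff_at_param.
exists (\det H); split.
  rewrite -det_map_mx HE (_ : Hy y0 = 1%:M) ?det1 ?oner_neq0 //.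
  apply/matrixP => i j; rewrite !mxE EE; have [_ <-] := hg (ev i).
  by rewrite mcoeffX -bmeqP val_eqE (inj_eq enum_val_inj).
move=> y; rewrite -det_map_mx HE => hdet u [i ui].
apply: contrapT => /forallNP hu.
have {}hu j : (at_param y (D j)).@[u] = 0 by apply/eqP; apply: contrapT => /negP/hu.
(* At a common zero u of the forms, the vector of the values at u of the monomials of degree N is in
   the kernel of [Hy y]; its entry u_i^N would be 0. *)
pose w : 'cV[K]_#|T| := \col_j \prod_l u l ^+ (bmnm (val (ev j)) l).
have Hw : Hy y *m w = 0.
  apply/matrixP => i0 j0; rewrite !mxE.
  transitivity (at_param y (E (ev i0))).@[u]; last first.
    by rewrite EE rmorph_sum big1 // => j _; rewrite rmorphM /= hu mulr0.
  have hE : at_param y (E (ev i0)) \is N.-homog.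
    rewrite EE; apply: rpred_sum => j _; have [hgj _] := hg (ev i0).
    rewrite (_ : N = N - delta + delta)%N; last by rewrite subnK // /N leq_addr.
    by apply: dhomogM; rewrite ?at_param_homog.
  rewrite [in RHS](homog_sum hE) raddf_sum [RHS]big_enum_val /=.
  by apply: eq_bigr => j _; rewrite !mxE mevalZ mevalX.
have w0 : w = 0.
  have uH : Hy y \in unitmx by rewrite unitmxE unitfE.
  by rewrite -(mulKmx uH w) Hw mulmx0.
have TN : mdeg (U_(i) *+ N)%MM == N by rewrite mdegMn mdeg1 mul1n.
have TN' : (mdeg (U_(i) *+ N)%MM < N.+1)%N by rewrite (eqP TN).
pose m : T := exist (fun m : 'X_{1..a < N.+1} => mdeg m == N) (BMultinom TN') TN.
move/matrixP: w0 => /(_ (enum_rank m) 0); rewrite !mxE /ev enum_rankK (bigD1 i) //= mulmnE mnm1E eqxx mul1n.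
rewrite big1 ?mulr1 => [/eqP|l /negPf li]; last by rewrite mulmnE mnm1E eq_sym li mul0n.
by rewrite expf_eq0 (negPf ui) andbF.
Qed.

(** Full row rank means that some maximal minor is nonzero. Entries of one row share a degree in u,
    so all these minors are forms of the same degree and elimination applies. *)
Lemma row_free_open r c (A : 'M[{mpoly {mpoly K[M]}[a]}]_(r, c)) (d : 'I_r -> nat) y0 :
  let at_point y u := map_mx (fun F => (at_param y F).@[u]) A in
  (forall i j, A i j \is (d i).-homog) ->
  (forall u : 'I_a -> K, (exists i, u i != 0) -> row_free (at_point y0 u)) ->
  exists s : {mpoly K[M]}, s.@[y0] != 0 /\ forall y, s.@[y] != 0 ->
    forall u : 'I_a -> K, (exists i, u i != 0) -> row_free (at_point y u).
Proof.
move=> at_point hA h0.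
have minorE y u (f : {ffun 'I_r -> 'I_c}) :
    (at_param y (\det (colsub f A))).@[u] = \det (colsub f (at_point y u)).
  rewrite at_paramE -!det_map_mx; congr (\det _).
  by apply/matrixP => i j; rewrite !mxE at_paramE.
have [||s [s0 hs]] := @elimination_open {ffun 'I_r -> 'I_c}
    (fun f => \det (colsub f A)) (\sum_i d i)%N y0.
- by move=> f; apply: dhomog_det => i j; rewrite mxE.
- by move=> u /h0 /row_free_minor [f hf]; exists f; rewrite minorE.
exists s; split=> // y sy u hu; apply/row_free_minor.
by have [f hf] := hs y sy u hu; exists f; rewrite -minorE.
Qed.

End Openness.

Section Combinations.
Context (K : fieldType) (N a k : nat) (es : 'I_a -> {mpoly K[N]}).

Definition combination (u : 'I_a -> K) : {mpoly K[N]} := \sum_i u i *: es i.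

Lemma combination_homog u : (forall i, es i \is k.-homog) -> combination u \is k.-homog.
Proof. by move=> hes; apply: rpred_sum => i _; apply: rpredZ; apply: hes. Qed.

Definition no_zero_divisors (B : {mpoly K[N]}) := forall u v,
  (exists h, combination u * combination v = h * B) ->
  (forall i, u i = 0) \/ (forall i, v i = 0).

End Combinations.

Section Bilinear.
Context (K : closedFieldType) (N M a k D : nat).
Hypothesis uK : uncountable K.
Context (es : 'I_a -> {mpoly K[N]}).
Hypothesis es_homog : forall i, es i \is k.-homog.

Let T : finType := {m : 'X_{1..N < (k + k - D).+1} | mdeg m == (k + k - D)%N}.
Let ev (l : 'I_#|T|) : 'X_{1..N} := bmnm (val (enum_val l : T)).

Let cofactor_of (h : 'I_#|T| -> K) : {mpoly K[N]} := \sum_l h l *: 'X_[ev l].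

Let cofactor_ofP h l : (cofactor_of h)@_(ev l) = h l.
Proof.
rewrite /cofactor_of raddf_sum (bigD1 l) //= mcoeffZ mcoeffX eqxx mulr1 big1 ?addr0 // => j jl.
rewrite mcoeffZ mcoeffX -bmeqP val_eqE (inj_eq enum_val_inj) (negPf jl) mulr0 //.
Qed.

Let cofactor_of_homog h : cofactor_of h \is (k + k - D).-homog.
Proof.
apply: rpred_sum => l _; apply: rpredZ; rewrite dhomogX.
exact: (valP (enum_val l : T)).
Qed.

Let cofactor_of_onto h : h \is (k + k - D).-homog -> h = cofactor_of (fun l => h@_(ev l)).
Proof. by move=> hh; rewrite [LHS](homog_sum hh) big_enum_val. Qed.

Variable BB : {mpoly {mpoly K[M]}[N]}.
Hypothesis BB_homog : BB \is D.-homog.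

Let c := #|{: 'X_{1..N < (k + k).+1}}|.
Let col (m : 'I_c) : 'X_{1..N} := bmnm (enum_val m).

(** At a given u the rows are the products of [combination es u] with the [es j], then the monomial
    multiples of [BB] of degree 2k. A left kernel vector (v, h) is a relation between a product of
    two combinations and a multiple of [BB], so for [BB] != 0 the absence of zero divisors is full
    row rank at every u != 0. *)
Let A : 'M[{mpoly {mpoly K[M]}[a]}]_(a + #|T|, c) :=
  col_mx (\matrix_(j, m) \sum_i (((es i * es j)@_(col m))%:MP%:MP * 'X_i))
         (\matrix_(l, m) (('X_[ev l] * BB)@_(col m))%:MP).

Let degree (i : 'I_(a + #|T|)) : nat := if split i is inl _ then 1 else 0.

Let A_homog i j : A i j \is (degree i).-homog.
Proof.
rewrite mxE /degree; case: split => l; rewrite mxE.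
  apply: rpred_sum => l' _; rewrite mul_mpolyC; apply: rpredZ.
  by rewrite dhomogX; apply/eqP; apply: mdeg1.
rewrite -[_%:MP]mulr1 mul_mpolyC; apply: rpredZ; exact: dhomog1.
Qed.

Let A_at y u := map_mx (fun F => (at_param y F).@[u]) A.

Let mul_A_at y u (v : 'rV[K]_a) (h : 'rV[K]_#|T|) m :
  (row_mx v h *m A_at y u) 0 m =
  (combination es u * combination es (v 0) + cofactor_of (h 0) * at_param y BB)@_(col m).
Proof.
rewrite /A_at map_col_mx mul_row_col mxE mcoeffD; congr (_ + _).
  rewrite mxE {2}/combination mulr_sumr raddf_sum; apply: eq_bigr => j _ /=.
  rewrite -scalerAr mcoeffZ !mxE; congr (_ * _).
  rewrite /combination mulr_suml at_param_sum !raddf_sum; apply: eq_bigr => i _ /=.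
  by rewrite -scalerAl mcoeffZ at_paramM at_paramC at_paramX mevalM !mevalC mevalXU mulrC.
rewrite mxE /cofactor_of mulr_suml raddf_sum; apply: eq_bigr => l _ /=.
rewrite -scalerAl mcoeffZ !mxE; congr (_ * _).
rewrite at_paramC mevalC -mcoeff_at_param at_paramM.
by rewrite at_paramX.
Qed.

Let homog_eq0 (F : {mpoly K[N]}) : F \is (k + k).-homog -> (forall m : 'I_c, F@_(col m) = 0) -> F = 0.
Proof.
move=> hF h; apply/mpolyP => m; rewrite mcoeff0.
have [mk|] := eqVneq (mdeg m) (k + k)%N; last exact: dhomog_nemf_coeff hF.
have mlt : (mdeg m < (k + k).+1)%N by rewrite mk.
by have := h (enum_rank (BMultinom mlt)); rewrite /col enum_rankK.
Qed.

Lemma no_zero_divisors_open y0 : (D <= k + k)%N -> at_param y0 BB != 0 ->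
  no_zero_divisors es (at_param y0 BB) ->
  exists s : {mpoly K[M]}, s.@[y0] != 0 /\
    forall y, s.@[y] != 0 -> no_zero_divisors es (at_param y BB).
Proof.
move=> Dk B0 nz0.
have homog_comb (y : 'I_M -> K) u v h : combination es u * combination es v + cofactor_of h * at_param y BB \is (k + k).-homog.
  apply: rpredD; first by apply: dhomogM; apply: combination_homog.
  have := dhomogM (cofactor_of_homog h) (at_param_homog y BB_homog).
  by rewrite subnK.
have [|s [s0 hs]] := @row_free_open K M a uK _ _ A degree y0 A_homog.
  move=> u [i ui]; apply: inj_row_free => w; rewrite -[w]hsubmxK => wA.
  set v := lsubmx w in wA *; set h := rsubmx w in wA *.
  have E : combination es u * combination es (v 0) + cofactor_of (h 0) * at_param y0 BB = 0.
    apply: homog_eq0 => // m; rewrite -mul_A_at /A_at wA mxE //.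
  have v0 : forall i, v 0 i = 0.
    have [|/(_ i) ui0|//] := nz0 u (v 0); last by move: ui; rewrite ui0 eqxx.
    by exists (- cofactor_of (h 0)); rewrite mulNr; apply/eqP; rewrite -addr_eq0 E.
  have h0 : cofactor_of (h 0) = 0.
    move: E; rewrite (_ : combination es (v 0) = 0); last first.
      by rewrite /combination big1 // => j _; rewrite v0 scale0r.
    by rewrite mulr0 add0r => /eqP; rewrite mulf_eq0 (negPf B0) orbF => /eqP.
  rewrite -row_mx0; congr (row_mx _ _); apply/rowP => j; rewrite [RHS]mxE //.
  by have := cofactor_ofP (h 0) j; rewrite h0 mcoeff0.
exists s; split=> // y sy u v [h E].
have [u0|/existsNP [i /eqP ui]] := pselect (forall i, u i = 0); [by left|right].
have fA := hs y sy u (ex_intro _ i ui).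
have hB : at_param y BB \is D.-homog by apply: at_param_homog.
have huv : combination es u * combination es v \is (k + k).-homog.
  by apply: dhomogM; apply: combination_homog.
have [h' [hh' E']] : exists h', h' \is (k + k - D).-homog /\
    combination es u * combination es v = h' * at_param y BB.
  have [E0|[_ [h' ?]]] := homog_dvd hB huv (ex_intro _ h E); last by exists h'.
  by exists 0; rewrite mul0r; split=> //; apply: dhomog0.
pose w := row_mx (\row_j v j) (\row_l - h'@_(ev l)).
have /eqP : w *m A_at y u = 0.
  apply/rowP => m; rewrite mul_A_at mxE.
  have -> : cofactor_of ((\row_l - h'@_(ev l)) 0) = - h'.
    rewrite [in RHS](cofactor_of_onto hh') /cofactor_of -sumrN.
    by apply: eq_bigr => l _; rewrite mxE scaleNr.
  have -> : combination es ((\row_j v j) 0) = combination es v.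
    by apply: eq_bigr => j _; rewrite mxE.
  by rewrite E' mulNr subrr mcoeff0.
rewrite (mulmx_free_eq0 _ fA) -row_mx0 => /eqP /eq_row_mx [/rowP v0 _] j.
by have := v0 j; rewrite !mxE.
Qed.

End Bilinear.

(** * Dimension of the family *)

Section Jacobian.
Context (K : numClosedFieldType).

Lemma mderivXU (n : nat) (a i : 'I_n) : ('X_a : {mpoly K[n]})^`M(i) = ((a == i)%:R)%:MP.
Proof.
rewrite mderivX mnm1E; case: eqVneq => [->|_]; last by rewrite scale0r mpolyC0.
rewrite scale1r mpolyC1 -mpolyX0; congr 'X_[_]; apply/mnmP => j.
by rewrite mnmBE subnn mnm0E.
Qed.

Lemma mderiv_comp (r n : nat) (F : r.-tuple {mpoly K[n]}) (g : {mpoly K[r]}) i :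
  (g \mPo F)^`M(i) = \sum_j (g^`M(j) \mPo F) * (tnth F j)^`M(i).
Proof.
elim/mpoly_ring_ind: g => [c|l|f g IHf IHg|f g IHf IHg].
- rewrite comp_mpolyC mderivC big1 // => j _.
  by rewrite mderivC -mpolyC0 comp_mpolyC mpolyC0 mul0r.
- rewrite comp_mpolyXU -tnth_nth (bigD1 l) //= mderivXU eqxx comp_mpolyC mpolyC1 mul1r.
  rewrite big1 ?addr0 // => j /negPf jl.
  by rewrite mderivXU eq_sym jl comp_mpolyC mpolyC0 mul0r.
- rewrite comp_mpolyD mderivD IHf IHg -big_split; apply: eq_bigr => j _.
  by rewrite mderivD comp_mpolyD mulrDl.
rewrite rmorphM mderivM IHf IHg mulr_suml mulr_sumr -big_split; apply: eq_bigr => j _ /=.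
by rewrite mderivM comp_mpolyD !rmorphM; ring.
Qed.

Lemma msize_mderiv_le (r b : nat) (g : {mpoly K[r]}) i :
  (msize g <= b.+1)%N -> (msize g^`M(i) <= b)%N.
Proof.
move=> hg; rewrite msizeE; apply/bigmax_leqP_seq => m mg _.
have : (m + U_(i))%MM \in msupp g.
  by move: mg; rewrite !mcoeff_msupp mcoeff_deriv mulrn_eq0.
by move=> /msize_mdeg_lt /leq_trans/(_ hg); rewrite mdegD mdeg1 addn1.
Qed.

(** By the chain rule the Jacobian matrix kills the vector of the (d_j g)(F); it is invertible over
    the fraction field, so these vanish too. By induction on the size all d_j g are 0, and in
    characteristic zero [g] is constant. *)
Lemma jacobian_independent (r : nat) (F : r.-tuple {mpoly K[r]}) (x : 'I_r -> K) :
  \det (\matrix_(i, j) ((tnth F j)^`M(i)).@[x]) != 0 ->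
  forall g : {mpoly K[r]}, g \mPo F = 0 -> g = 0.
Proof.
move=> hdet; pose J : 'M[{mpoly K[r]}]_r := \matrix_(i, j) (tnth F j)^`M(i).
have J0 : \det J != 0.
  apply: contraNneq hdet => E; rewrite (_ : \matrix_(i, j) _ = map_mx (meval x) J).
    by rewrite det_map_mx E rmorph0.
  by apply/matrixP => i j; rewrite !mxE.
move=> g; have [b] := ubnP (msize g); elim: b g => [//|b IH] g; rewrite ltnS => gb gF.
have [b0|b0] := eqVneq b 0%N.
  by apply/eqP; rewrite -msize_poly_eq0 -leqn0 -b0.
have dg j : g^`M(j) = 0.
  apply: IH; first by rewrite -(prednK (n := b)) ?lt0n // ltnS msize_mderiv_le // prednK // lt0n.
  pose w : 'cV[{mpoly K[r]}]_r := \col_j (g^`M(j) \mPo F).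
  have Jw : J *m w = 0.
    apply/matrixP => i0 j0; rewrite !mxE.
    transitivity ((g \mPo F)^`M(i0)); last by rewrite gF raddf0.
    by rewrite mderiv_comp; apply: eq_bigr => l _; rewrite !mxE mulrC.
  have /matrixP/(_ j 0) : \det J *: w = 0.
    by rewrite -mul_scalar_mx -mul_adj_mx -mulmxA Jw mulmx0.
  by rewrite !mxE => /eqP; rewrite mulf_eq0 (negPf J0) => /eqP.
have gC : g = (g@_0)%:MP.
  apply/mpolyP => m; rewrite mcoeffC; have [->|m0] := eqVneq m 0%MM; first by rewrite mulr1.
  rewrite mulr0; have [i mi] : exists i, m i != 0%N.
    apply: contrapT => /forallNP h; move/eqP: m0; apply; apply/mnmP => i; rewrite mnm0E.
    by apply/eqP; apply: contrapT => /negP/h.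
  have Em : m = (m - U_(i) + U_(i))%MM.
    by rewrite submK // lep1mP.
  have := mcoeff_deriv i (m - U_(i))%MM g; rewrite dg mcoeff0 -Em => /esym/eqP.
  by rewrite mulrn_eq0 => /eqP.
by move: gF; rewrite gC comp_mpolyC => /eqP; rewrite mpolyC_eq0 => /eqP ->; rewrite mpolyC0.
Qed.

End Jacobian.

Section Cone.
Context (K : numClosedFieldType) (n D N : nat).
Hypothesis uK : uncountable K.
Implicit Types (F G : {mpoly K[n.+1]}).

Definition coef_row F : 'rV[K]_(ncoef n D) := \row_i coefs D F i.

Lemma coef_rowD F G : coef_row (F + G) = coef_row F + coef_row G.
Proof. by apply/rowP => i; rewrite !mxE /coefs mcoeffD. Qed.

Lemma coef_rowZ a F : coef_row (a *: F) = a *: coef_row F.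
Proof. by apply/rowP => i; rewrite !mxE /coefs mcoeffZ. Qed.

Lemma coef_row_sum (I : finType) (F : I -> {mpoly K[n.+1]}) :
  coef_row (\sum_i F i) = \sum_i coef_row (F i).
Proof.
apply/rowP => i; rewrite summxE !mxE /coefs raddf_sum; apply: eq_bigr => l _.
by rewrite mxE.
Qed.

Lemma coef_row_eq0 F : F \is D.-homog -> coef_row F = 0 -> F = 0.
Proof.
move=> hF E; apply/mpolyP => m; rewrite mcoeff0.
have [mD|] := eqVneq (mdeg m) D; last exact: dhomog_nemf_coeff hF.
have mlt : (mdeg m < D.+1)%N by rewrite mD.
by move/rowP: E => /(_ (enum_rank (BMultinom mlt))); rewrite !mxE /coefs enum_rankK.
Qed.

Context (c p q : {mpoly K[n.+1]}) (e : 'I_N -> {mpoly K[n.+1]}).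
Hypothesis c_homog : c \is D.-homog.
Hypothesis pe_homog : forall i, p * e i \is D.-homog.

Definition param_form (t : 'I_N -> K) := \sum_i t i *: e i.

Hypothesis indep : forall a t, a *: c + p * param_form t = 0 -> a = 0 /\ forall i, t i = 0.

Definition family_member t := c - 2%:R *: (p * param_form t) - q * param_form t ^+ 2.

(* At (a, t) = (1, 0) the coordinates dual to c, p e_1, ..., p e_N of a B_t have the
   invertible Jacobian diag (1, -2, ..., -2). *)
Lemma family_dimension (s : {mpoly K[N]}) (Y : {mpoly K[n.+1]} -> Prop) :
  s.@[fun=> 0] != 0 ->
  (forall a t, a != 0 -> s.@[t] != 0 -> Y (a *: family_member t)) -> dim_geq D Y N.+1.
Proof.
move=> s0 hY.
pose A : 'M[K]_(N.+1, ncoef n D) :=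
  \matrix_i if unlift ord0 i is Some j then coef_row (p * e j) else coef_row c.
have A0 : row ord0 A = coef_row c by rewrite rowK unlift_none.
have Al j : row (lift ord0 j) A = coef_row (p * e j) by rewrite rowK liftK.
have fA : row_free A.
  apply: inj_row_free => w wA.
  have E : coef_row (w 0 0 *: c + p * param_form (fun j => w 0 (lift ord0 j))) = 0.
    rewrite -wA mulmx_sum_row big_ord_recl A0 coef_rowD coef_rowZ; congr (_ + _).
    rewrite /param_form mulr_sumr coef_row_sum; apply: eq_bigr => j _.
    by rewrite Al -scalerAr coef_rowZ.
  have [|w0 wl] := indep (a := w 0 0) (t := fun j => w 0 (lift ord0 j)).
    apply: coef_row_eq0 E; apply: rpredD; first exact: rpredZ.
    rewrite /param_form mulr_sumr; apply: rpred_sum => j _.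
    by rewrite -scalerAr; apply: rpredZ; apply: pe_homog.
  apply/rowP => i; rewrite mxE; case: (unliftP ord0 i) => [j ->|-> //].
  exact: wl.
(* A right inverse of [A]: its columns are linear functions of the coefficients, dual to [c] and the
   [p * e i]. *)
pose Phi := pinvmx A.
have APhi : A *m Phi = 1%:M by apply: mulmxVp.
pose phi F j : K := (coef_row F *m Phi) 0 j.
have phic j : phi c j = (j == ord0)%:R.
  by rewrite /phi -A0 -row_mul APhi !mxE eq_sym.
have phip i j : phi (p * e i) j = (j == lift ord0 i)%:R.
  by rewrite /phi -Al -row_mul APhi !mxE eq_sym.
have phiD F G j : phi (F + G) j = phi F j + phi G j.
  by rewrite /phi coef_rowD mulmxDl mxE.
have phiZ a F j : phi (a *: F) j = a * phi F j.
  by rewrite /phi coef_rowZ -scalemxAl mxE.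
have phi_sum (I : finType) (F : I -> {mpoly K[n.+1]}) j : phi (\sum_i F i) j = \sum_i phi (F i) j.
  by rewrite /phi coef_row_sum mulmx_suml summxE.
exists (fun j => \sum_i Phi i j *: 'X_i) => g hg.
have evphi F j : (\sum_i Phi i j *: 'X_i).@[coefs D F] = phi F j.
  rewrite raddf_sum /phi mxE; apply: eq_bigr => i _ /=.
  by rewrite mevalZ mevalXU [coef_row F _ _]mxE mulrC.
(* The coordinate j of B_t as a polynomial in t, with t_i the variable of index [lift ord0 i]; the
   variable of index [ord0] is the scalar of the cone. The three terms come from c, - 2 p m and - q
   m^2. *)
pose L j : {mpoly K[N.+1]} := ((j == ord0)%:R)%:MP
  - \sum_i (2%:R * (j == lift ord0 i)%:R) *: 'X_(lift ord0 i)
  - \sum_i \sum_l phi (q * (e i * e l)) j *: ('X_(lift ord0 i) * 'X_(lift ord0 l)).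
pose Fam := [tuple 'X_ord0 * L j | j < N.+1].
have FamE j (x : 'I_N.+1 -> K) : (tnth Fam j).@[x] =
    phi (x ord0 *: family_member (fun i => x (lift ord0 i))) j.
  rewrite tnth_mktuple mevalM mevalXU phiZ; congr (_ * _).
  rewrite /family_member -scaleN1r -[- (q * _)]scaleN1r !(phiD, phiZ) phic.
  rewrite /L !mevalB mevalC !mulN1r; congr (_ - _ - _).
    rewrite /param_form mulr_sumr phi_sum mulr_sumr raddf_sum; apply: eq_bigr => i _ /=.
    by rewrite mevalZ mevalXU -scalerAr phiZ phip; ring.
  rewrite /param_form expr2 mulr_suml mulr_sumr phi_sum raddf_sum; apply: eq_bigr => i _ /=.
  rewrite !mulr_sumr phi_sum raddf_sum; apply: eq_bigr => l _ /=.
  rewrite mevalZ mevalM !mevalXU -scalerAr -scalerAl -!scalerAr !phiZ.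
  by ring.
apply: (@jacobian_independent _ _ Fam (fun i => (i == ord0)%:R)).
  pose dg : 'rV[K]_N.+1 := \row_j if j == ord0 then 1 else - 2%:R.
  rewrite (_ : \matrix_(i, j) _ = diag_mx dg).
    rewrite det_diag prodf_seq_neq0; apply/allP => j _ /=; rewrite mxE.
    by case: ifP => _; rewrite ?oppr_eq0 ?pnatr_eq0 ?oner_eq0.
  have xl l : (lift ord0 l == ord0 :> 'I_N.+1) = false by apply/negbTE; rewrite eq_sym neq_lift.
  have Lx j : (L j).@[fun i => (i == ord0)%:R] = (j == ord0)%:R.
    rewrite /L !mevalB mevalC !(raddf_sum (meval _)) /= !big1 ?subr0 // => l _.
      rewrite raddf_sum big1 // => l' _ /=.
      by rewrite mevalZ mevalM !mevalXU xl mul0r mulr0.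
    by rewrite mevalZ mevalXU xl mulr0.
  have dLx i j : ((L j)^`M(i)).@[fun i => (i == ord0)%:R] =
      - \sum_l 2%:R * (j == lift ord0 l)%:R * (lift ord0 l == i)%:R.
    rewrite /L !mderivB mderivC sub0r !(raddf_sum (mderiv i)) /= mevalB mevalN !(raddf_sum (meval _)) /=.
    rewrite [X in _ - X]big1 ?subr0 => [|l _].
      congr (- _); apply: eq_bigr => l _.
      by rewrite mderivZ mderivXU mevalZ mevalC.
    rewrite (raddf_sum (mderiv i)) (raddf_sum (meval _)) big1 // => l' _ /=.
    by rewrite mderivZ mderivM !mderivXU mevalZ mevalD !mevalM !mevalC !mevalXU !xl !(mulr0, mul0r) addr0 mulr0.
  apply/matrixP => i j; rewrite !mxE tnth_mktuple mderivM mevalD !mevalM mderivXU mevalC mevalXU eqxx.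
  rewrite Lx dLx mul1r.
  case: (unliftP ord0 j) => [j' ->|->].
    rewrite xl mulr0 add0r (bigD1 j') //= big1 ?addr0 => [|l lj].
      rewrite eqxx mulr1 [i == lift _ _]eq_sym.
      by case: eqVneq => [<-|_]; rewrite ?xl ?mulr1 ?mulr1n // mulr0 oppr0 mulr0n.
    by rewrite (inj_eq lift_inj) eq_sym (negPf lj) mulr0 mul0r.
  rewrite eqxx mulr1 big1 ?oppr0 ?addr0 => [|l _]; first by rewrite eq_sym; case: eqP.
  by rewrite [ord0 == _]eq_sym xl mulr0 mul0r.
(* The hypothesis on [g] is available only where the scalar and s(t) are nonzero. The product with
   both vanishes everywhere, and these factors are nonzero polynomials because s(0) != 0. *)
have key : (g \mPo Fam) * ('X_ord0 * (s \mPo [tuple 'X_(lift ord0 i) | i < N])) = 0.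
  apply: contrapT => /eqP /(mpoly_nonvanishing uK) [x].
  rewrite !mevalM !comp_mpoly_meval mevalXU mulf_eq0 negb_or mulf_eq0 negb_or.
  move=> /and3P[gx x0 sx]; move/eqP: gx; apply.
  have := hg (x ord0 *: family_member (fun i => x (lift ord0 i))).
  rewrite (meval_eq (v2 := fun j => (tnth Fam j).@[x])) => [->//|j]; last by rewrite evphi FamE.
  apply: hY => //; move: sx; congr (_ != 0); apply: meval_eq => i.
  by rewrite tnth_mktuple mevalXU.
move/eqP: key; rewrite mulf_eq0 mulf_eq0 (negPf (mpolyX_neq0 _ _)) /=.
move=> /orP[/eqP //|/eqP E].
have Es : (s \mPo [tuple 'X_(lift ord0 i) | i < N]).@[fun=> 0] = s.@[fun=> 0].
  by rewrite comp_mpoly_meval; apply: meval_eq => i; rewrite tnth_mktuple mevalXU.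
by move: s0; rewrite -Es E meval0 eqxx.
Qed.

End Cone.

(** * Good pairs and the contact locus *)

Section CoprimeOpen.
Context (K : fieldType) (M n : nat).
Implicit Types (AA BB : {mpoly {mpoly K[M]}[n]}) (x p : 'I_n -> K) (y : 'I_M -> K).

Definition param_line x p BB : {poly {mpoly K[M]}} :=
  along idfun (fun i => (x i)%:MP) (fun i => (p i)%:MP) BB.

Lemma map_param_line x p BB y :
  map_poly (meval y) (param_line x p BB) = on_line x p (at_param y BB).
Proof.
rewrite /param_line on_lineE /along rmorph_mmap at_paramE /map_mpoly.
rewrite -[RHS]/(along idfun x p _) rmorph_mmap; apply: eq_mmap => i /=.
  by rewrite map_polyC /= /along mmapC.
rewrite rmorphD /= map_polyC map_polyZ map_polyX /= !mevalC.
by rewrite /along mmapX mmap1U.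
Qed.

Lemma meval_at_param p BB y : BB.@[fun i => (p i)%:MP].@[y] = (at_param y BB).@[p].
Proof.
rewrite at_paramE /map_mpoly /meval !rmorph_mmap; apply: eq_mmap => [z|i] /=.
  by rewrite -/(meval _ _) mmapC.
by rewrite -/(meval _ _) mevalC mmapX mmap1U.
Qed.

(** The elimination polynomial detects coprimality only where the leading coefficient [c], the value
    of [BB] at [p], survives the specialisation; hence [s] = N c. *)
Lemma coprime_open D x p AA BB y0 : BB \is D.-homog -> (at_param y0 BB).@[p] != 0 ->
  coprimep (on_line x p (at_param y0 BB)) (on_line x p (at_param y0 AA)) ->
  exists s : {mpoly K[M]}, s.@[y0] != 0 /\ forall y, s.@[y] != 0 ->
    (at_param y BB).@[p] != 0 /\
    coprimep (on_line x p (at_param y BB)) (on_line x p (at_param y AA)).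
Proof.
move=> hB Bp cop; set c := BB.@[fun i => (p i)%:MP].
have cE y : c.@[y] = (at_param y BB).@[p] by apply: meval_at_param.
have szB : (msize BB <= D.+1)%N.
  by rewrite msizeE; apply/bigmax_leqP_seq => m mF _; rewrite (dhomog_mf hB mF).
have [sz cD] : top_coef D (param_line x p BB) c.
  by have := top_coef_along idfun (fun i => (x i)%:MP) (fun i => (p i)%:MP) szB; rewrite pihomog_dE.
have c0 : c != 0 by apply: contraNneq Bp => E; rewrite -cE E meval0.
have lc : lead_coef (param_line x p BB) = c.
  rewrite lead_coefE; suff -> : size (param_line x p BB) = D.+1 by [].
  apply/eqP; rewrite eqn_leq sz /= ltnNge; apply/negP => sz'.
  by move: cD; rewrite nth_default // => /esym/eqP; rewrite (negPf c0).
have f0 : param_line x p BB != 0 by rewrite -lead_coef_eq0 lc.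
have mA y := map_param_line x p AA y; have mB y := map_param_line x p BB y.
move: (param_line x p AA) (param_line x p BB) lc f0 mA mB {sz cD} => lA lB lc f0 mA mB.
have [N [u [v [_ hN]]]] := elimination lA f0.
have hN' y : c.@[y] != 0 -> (N.@[y] != 0) = coprimep (on_line x p (at_param y BB)) (on_line x p (at_param y AA)).
  have := hN K (meval y : {rmorphism {mpoly K[M]} -> K}).
  by rewrite lc mA mB.
exists (N * c); split=> [|y].
  by rewrite mevalM mulf_neq0 ?hN' ?cE.
by rewrite mevalM mulf_eq0 negb_or => /andP[Ny cy]; split; rewrite -?cE // -hN'.
Qed.

End CoprimeOpen.

Section Good.
Context (K : closedFieldType) (n k D a : nat).
Hypothesis uK : uncountable K.
Context (es : 'I_a -> {mpoly K[n]}).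
Hypothesis es_homog : forall i, es i \is k.-homog.

(* An open condition ensuring that A is determined up to sign by its square modulo B. *)
Definition good_pair (A B : {mpoly K[n]}) :=
  (exists x p, B.@[p] != 0 /\ coprimep (on_line x p B) (on_line x p A)) /\
  no_zero_divisors es B.

Lemma good_pair_open M (AA BB : {mpoly {mpoly K[M]}[n]}) y0 :
  BB \is D.-homog -> (D <= k + k)%N -> good_pair (at_param y0 AA) (at_param y0 BB) ->
  exists s : {mpoly K[M]}, s.@[y0] != 0 /\ forall y, s.@[y] != 0 ->
    good_pair (at_param y AA) (at_param y BB).
Proof.
move=> hB Dk [[x [p [Bp cop]]] nz].
have [s [s0 hs]] := coprime_open hB Bp cop.
have B0 : at_param y0 BB != 0 by apply: contraNneq Bp => ->; rewrite meval0.
have [s' [s'0 hs']] := no_zero_divisors_open uK es_homog hB Dk B0 nz.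
exists (s * s'); split=> [|y]; first by rewrite mevalM mulf_neq0.
rewrite mevalM mulf_eq0 negb_or => /andP[sy s'y]; split; last exact: hs'.
by exists x, p; apply: hs.
Qed.

End Good.

(** * Bases of spaces of forms *)

Section Bases.
Context (K : fieldType) (n k : nat).

Lemma vspace_forms_basis (V : {vspace dhomog n.+1 K k}) :
  exists es : 'I_(\dim V) -> {mpoly K[n.+1]},
    [/\ forall i, exists2 v, v \in V & es i = mpoly_of_dhomog v,
      forall u, combination es u = 0 -> forall i, u i = 0 &
      forall v, v \in V -> exists u, mpoly_of_dhomog v = combination es u].
Proof.
pose b := vbasis V; exists (fun i => mpoly_of_dhomog b`_i).
have combE u : combination (fun i : 'I_(\dim V) => mpoly_of_dhomog b`_i) u =
    mpoly_of_dhomog (\sum_i u i *: b`_i).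
  by rewrite /combination raddf_sum; apply: eq_bigr.
split=> [i|u|v vV].
- by exists b`_i => //; apply: vbasis_mem; apply: mem_nth; rewrite size_tuple.
- rewrite combE => E; have /freeP/(_ u) := basis_free (vbasisP V).
  by apply; apply: val_inj; exact: E.
exists (fun i => coord b i v); rewrite combE -coord_vbasis //.
Qed.

Lemma forms_basis :
  exists es : 'I_(\dim {: dhomog n.+1 K k}) -> {mpoly K[n.+1]},
    [/\ forall i, es i \is k.-homog, forall u, combination es u = 0 -> forall i, u i = 0 &
      forall F, F \is k.-homog -> exists u, F = combination es u].
Proof.
have [es [hom free span]] := vspace_forms_basis {: dhomog n.+1 K k}.
exists es; split=> // [i|F hF]; first by have [v _ ->] := hom i; apply: dhomog_is_dhomog.
by have [u] := span (DHomog hF) (memvf _); exists u.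
Qed.

(** As [P] has degree k itself, the forms of degree k in (P, Q) are spanned by [P] and the monomial
    multiples of [Q]. *)
Lemma ideal_forms_basis q (P Q : {mpoly K[n.+1]}) : P \is k.-homog -> Q \is q.-homog ->
  (q <= k)%N -> exists a (es : 'I_a -> {mpoly K[n.+1]}),
    [/\ forall i, es i \is k.-homog, forall u, combination es u = 0 -> forall i, u i = 0,
      forall u, in_ideal [:: P; Q] (combination es u) &
      forall F, F \is k.-homog -> in_ideal [:: P; Q] F -> exists u, F = combination es u].
Proof.
move=> hP hQ qk.
pose T : finType := {m : 'X_{1..n.+1 < (k - q).+1} | mdeg m == (k - q)%N}.
have hXQ (m : T) : 'X_[bmnm (val m)] * Q \is k.-homog.
  have hX : ('X_[bmnm (val m)] : {mpoly K[n.+1]}) \is (k - q).-homog.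
    by rewrite dhomogX; exact: (valP m).
  by have := dhomogM hX hQ; rewrite subnK.
pose g (o : option T) : dhomog n.+1 K k := if o is Some m then DHomog (hXQ m) else DHomog hP.
pose X := [seq g o | o : option T]; pose V := <<X>>%VS.
have [es [hom free span]] := vspace_forms_basis V.
have homV u : in_ideal [:: P; Q] (combination es u).
  rewrite /combination; apply: (@ideal_sum {mpoly K[n.+1]} (in_ideal [:: P; Q]) _ _ _ _ (in_idealP _)) => i _.
  have [_ _ IM] := in_idealP [:: P; Q]; rewrite -mul_mpolyC; apply: (IM _ _).
  have [v vV ->] := hom i; rewrite (coord_span (X := in_tuple X) vV) raddf_sum.
  apply: (@ideal_sum {mpoly K[n.+1]} (in_ideal [:: P; Q]) _ _ _ _ (in_idealP _)) => j _; rewrite /= -mul_mpolyC; apply: IM.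
  have : X`_j \in X by rewrite mem_nth.
  case/imageP => o _ ->; apply/in_ideal2; case: o => [m|].
    by exists 0, 'X_[bmnm (val m)]; rewrite mul0r add0r.
  by exists 1, 0; rewrite mul1r mul0r addr0.
exists (\dim V), es; split=> // [i|F hF iF].
  by have [v _ ->] := hom i; apply: dhomog_is_dhomog.
have [u [v [hu hv E]]] := homog_in_ideal2 hP hQ hF (leqnn k) qk iF.
suff FV : DHomog hF \in V by have [w] := span _ FV; exists w.
have -> : DHomog hF = u@_0 *: g None + \sum_(m : T) v@_(bmnm (val m)) *: g (Some m).
  apply: val_inj; rewrite /= raddf_sum /= E.
  rewrite subnn in hu; rewrite {1}(dhomog0_const hu) mul_mpolyC; congr (_ + _).
  rewrite {1}(homog_sum hv) mulr_suml; apply: eq_bigr => m _.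
  by rewrite scalerAl.
have gX o : g o \in X by apply: image_f.
by apply: memvD; [|apply: memv_suml => m _]; apply: memvZ; apply: memv_span.
Qed.

End Bases.

(** * Uniqueness of the contact form *)

Section Contact.
Context (K : numClosedFieldType) (n k d a : nat).
Hypothesis uK : uncountable K.
Hypotheses (hn : (2 <= n)%N) (hd : (0 < d)%N) (hdk : (d <= k)%N).
Context (P Q : {mpoly K[n.+1]}).
Hypotheses (P0 : P != 0) (Q0 : Q != 0) (hP : P \is k.-homog) (hQ : Q \is (k - d).-homog).
Hypothesis regPQ : regular_pair P Q.
Context (es : 'I_a -> {mpoly K[n.+1]}).
Hypothesis es_homog : forall i, es i \is k.-homog.
Hypothesis es_free : forall u, combination es u = 0 -> forall i, u i = 0.
Hypothesis es_ideal : forall u, in_ideal [:: P; Q] (combination es u).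
Hypothesis es_span : forall F, F \is k.-homog -> in_ideal [:: P; Q] F ->
  exists u, F = combination es u.
Implicit Types (A B W : {mpoly K[n.+1]}).

Lemma good_pair_regular A B : B \is (2 * d).-homog -> good_pair es A B -> regular_pair A B.
Proof.
move=> hB [[x [p [Bp cop]]] _].
by apply: (regular_on_line (msize_homog hB) _ cop); rewrite pihomog_dE.
Qed.

Lemma good_pair_neq0 A B : good_pair es A B -> B != 0.
Proof. by move=> [[x [p [Bp _]]] _]; apply: contraNneq Bp => ->; rewrite meval0. Qed.

Lemma one_notin_form_ideal B h : B \is (2 * d).-homog -> 1 = B * h -> False.
Proof.
move=> hB E; have h1 : (1 : {mpoly K[n.+1]}) \is 0.-homog by apply: dhomog1.
have [|/eqP|[]] := homog_dvd hB h1; first by exists h; rewrite mulrC.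
  by rewrite oner_eq0.
by rewrite leqn0 muln_eq0 /= (gtn_eqF hd).
Qed.

Lemma good_pair_neq0l A B : B \is (2 * d).-homog -> good_pair es A B -> A != 0.
Proof.
move=> hB gAB; apply/eqP => A0.
have [h E] : exists h, 1 = B * h.
  by apply: (good_pair_regular hB gAB (g := 0)); rewrite A0 mul0r mulr0.
exact: one_notin_form_ideal hB E.
Qed.

Lemma contact_unique w W A B : w != 0 -> w *: W = A ^+ 2 + Q ^+ 2 * B ->
  hypersurface (2 * k) W -> A \is k.-homog -> in_ideal [:: P; Q] A ->
  B \is (2 * d).-homog -> good_pair es A B ->
  exists A : {mpoly K[n.+1]},
    let contact A' :=
      [/\ hypersurface k A', subscheme [:: P; Q] [:: A'] & cuts_contact_locus W B A'] in
    contact A /\ forall A', contact A' -> same_hypersurface A A'.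
Proof.
move=> w0 EW [W0 hW] hA iA hB gAB.
have reg := good_pair_regular hB gAB; have B0 := good_pair_neq0 gAB.
have A0 := good_pair_neq0l hB gAB.
have regW f g : W * f = B * g -> exists h, f = B * h.
  move=> E.
  have [h Eh] : exists h, A * f = B * h.
    apply: (reg _ (w%:MP * g - Q ^+ 2 * f)).
    transitivity ((A ^+ 2 + Q ^+ 2 * B) * f - Q ^+ 2 * B * f); first by ring.
    by rewrite -EW -mul_mpolyC -mulrA E; ring.
  exact: reg _ _ Eh.
have cutA : cuts_divisor B (A ^+ 2).
  move=> G /in_ideal1 [u E]; apply/in_ideal1.
  have [h Eh] : exists h, A * G = B * h by apply: (reg _ u); rewrite mulrA -expr2 E mulrC.
  by have [h' Eh'] := reg _ _ Eh; exists h'; rewrite mulrC.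
have cutW : cuts_divisor B W.
  move=> G /in_ideal1 [u E]; apply/in_ideal1.
  by have [h Eh] := regW G u (etrans E (mulrC _ _)); exists h; rewrite mulrC.
exists A => /=; split.
  split=> //; first by move=> z _ h; rewrite inE => /eqP ->; apply: in_stalk_ideal.
  split=> //; split=> z _ h; rewrite !inE => /orP[]/eqP ->; apply: in_stalk_ideal; apply/in_ideal2.
  - by exists w%:MP, (- Q ^+ 2); rewrite mul_mpolyC EW; ring.
  - by exists 0, 1; rewrite mul0r mul1r add0r.
  - exists (w^-1)%:MP, ((w^-1)%:MP * Q ^+ 2).
    by rewrite -mulrA -mulrDr -EW mul_mpolyC scalerA mulVf // scale1r.
  - by exists 0, 1; rewrite mul0r mul1r add0r.
move=> A' [[A'0 hA'] sA' [_ _ [sWA _]]].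
have iA' : in_ideal [:: P; Q] A'.
  by apply: (stalks_in_ideal2 uK) => // z hz; apply: sA' => //; rewrite mem_head.
have hA'2 : A' ^+ 2 \is (2 * k).-homog by rewrite mulnC; apply: dhomogMn.
have [u [v [hu _ E]]] : exists u v, [/\ u \is (2 * k - 2 * k).-homog,
    v \is (2 * k - 2 * d).-homog & A' ^+ 2 = u * W + v * B].
  apply: (homog_in_ideal2 hW hB hA'2); rewrite ?leq_pmul2l //.
  apply: (stalks_in_ideal2 uK) => // z hz; apply: sWA => //; rewrite mem_head //.
rewrite subnn in hu; rewrite (dhomog0_const hu) in E.
(* The coefficient of [W] is constant because A'^2 and [W] both have degree 2k. Replacing [W] by
   (A^2 + Q^2 B) / w shows that (A' - r A)(A' + r A) is a multiple of [B], and both factors are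
   forms of degree k in (P, Q). *)
pose r := sqrtC (u@_0 / w).
have rE : r ^+ 2 * w = u@_0 by rewrite sqrtCK divfK.
have iI := in_idealP [:: P; Q]; have [_ _ IM] := iI.
have hrA : r%:MP * A \is k.-homog by rewrite mul_mpolyC; apply: rpredZ.
have irA : in_ideal [:: P; Q] (r%:MP * A) by apply: IM.
have [s Es] := es_span (rpredB hA' hrA) (idealB iI iA' irA).
have [s' Es'] : exists s', A' + r%:MP * A = combination es s'.
  apply: es_span; first exact: rpredD.
  by have [_ ID _] := iI; apply: ID.
have [_ nz] := gAB.
have same : r != 0 -> A' = r *: A \/ A' = (- r) *: A -> same_hypersurface A A'.
  by move=> r0 [->|->]; [exists r|exists (- r); rewrite ?oppr_eq0].
have A'r : A' = r *: A \/ A' = (- r) *: A.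
  case: (nz s s').
  - exists (r%:MP ^+ 2 * Q ^+ 2 + v); rewrite -Es -Es'.
    transitivity (A' ^+ 2 - (r ^+ 2)%:MP * A ^+ 2); first by rewrite rmorphXn; ring.
    rewrite E -rE mpolyCM -mulrA mul_mpolyC [w%:MP * _]mul_mpolyC EW rmorphXn /= -mul_mpolyC rmorphXn /=.
    by ring.
  - move=> s0; left; apply/eqP; rewrite -subr_eq0 -mul_mpolyC Es /combination big1 // => i _.
    by rewrite s0 scale0r.
  - move=> s0; right; apply/eqP; rewrite scaleNr -addr_eq0 -mul_mpolyC Es' /combination big1 // => i _.
    by rewrite s0 scale0r.
apply: same => //; apply: contraNneq A'0 => r0.
by case: A'r => ->; rewrite r0 ?oppr0 scale0r.
Qed.

End Contact.

Lemma sections_basis (K : fieldType) (n d k : nat) :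
  exists e : 'I_(h0 K n ((2 * d)%:Z - k%:Z)) -> {mpoly K[n.+1]},
    (forall i, (k <= 2 * d)%N /\ e i \is (2 * d - k).-homog) /\
    forall u, combination e u = 0 -> forall i, u i = 0.
Proof.
have [kd|dk] := leqP k (2 * d).
  rewrite subzn //=; have [e [he fe _]] := forms_basis K n (2 * d - k).
  by exists e; split=> // i; split.
have -> : h0 K n ((2 * d)%:Z - k%:Z) = 0%N.
  have : ((2 * d)%:Z - k%:Z < 0)%R by rewrite subr_lt0 ltz_nat.
  by rewrite /h0; case: (_ - _) => // j; rewrite ltNge.
by exists (fun=> 0); split=> [[]|u _ []].
Qed.

(** * The family through a good pair *)

Section Family.
Context (K : numClosedFieldType) (n k d a : nat).
Hypothesis uK : uncountable K.
Hypotheses (hn : (2 <= n)%N) (hd : (0 < d)%N) (hdk : (d <= k)%N).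
Context (P Q : {mpoly K[n.+1]}).
Hypotheses (P0 : P != 0) (Q0 : Q != 0) (hP : P \is k.-homog) (hQ : Q \is (k - d).-homog).
Hypothesis regPQ : regular_pair P Q.
Context (es : 'I_a -> {mpoly K[n.+1]}).
Hypothesis es_homog : forall i, es i \is k.-homog.
Hypothesis es_free : forall u, combination es u = 0 -> forall i, u i = 0.
Hypothesis es_ideal : forall u, in_ideal [:: P; Q] (combination es u).
Hypothesis es_span : forall F, F \is k.-homog -> in_ideal [:: P; Q] F ->
  exists u, F = combination es u.

(* For c prime, a form of degree k of (P, Q) divisible by c is h * c with h in (P, Q), since
   c is regular modulo (P, Q), and h has degree k - 2d < k - d, hence h = 0. *)
Lemma exists_good_pair (zs : seq {ffun 'I_n.+1 -> K}) :
  {in zs, forall z : {ffun 'I_n.+1 -> K}, is_point z /\ P.@[z] = 0} ->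
  (forall c : {mpoly K[n.+1]}, {in zs, forall z : {ffun 'I_n.+1 -> K}, c.@[z] != 0} ->
    forall y, in_ideal [:: P; Q] (c * y) -> in_ideal [:: P; Q] y) ->
  exists c : {mpoly K[n.+1]}, [/\ c \is (2 * d).-homog,
    {in zs, forall z : {ffun 'I_n.+1 -> K}, c.@[z] != 0} & good_pair es P c].
Proof.
move=> hzs reg.
have k0 : (0 < k)%N by apply: leq_trans hd hdk.
have [|c [y [p [hc prime_c c_zs cp cop]]]] := exists_prime_form uK hn _ hP k0 P0 hzs (e := (2 * d).-1).
  by lia.
have d2 : (2 * d).-1.+1 = (2 * d)%N by lia.
rewrite d2 in hc; exists c; split=> //; split; first by exists y, p.
have small u : (exists h, combination es u = h * c) -> forall i, u i = 0.
  move=> hu; apply: es_free.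
  have hcu : combination es u \is k.-homog by apply: combination_homog.
  have [//|[dk [h [hh E]]]] := homog_dvd hc hcu hu.
  suff hz : h = 0 by rewrite E hz mul0r.
  apply: (homog_in_ideal2_small hP hQ hh); [by lia|by lia|].
  by apply: (reg c) => //; rewrite mulrC -E.
by move=> u v /prime_c [] /small; [left|right].
Qed.

Lemma family_exists w W p c : w != 0 -> w *: W = p ^+ 2 + Q ^+ 2 * c ->
  hypersurface (2 * k) W -> p \is k.-homog -> in_ideal [:: P; Q] p ->
  c \is (2 * d).-homog -> good_pair es p c ->
  exists_family (2 * d) (h0 K n ((2 * d)%:Z - k%:Z))
    (fun B =>
       exists A : {mpoly K[n.+1]},
         let contact A' :=
           [/\ hypersurface k A', subscheme [:: P; Q] [:: A']
             & cuts_contact_locus W B A'] in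
         contact A /\ forall A', contact A' -> same_hypersurface A A').
Proof.
move=> w0 EW hW hp ip hc gpc.
have k0 : (0 < k)%N by apply: leq_trans hd hdk.
have [e [he fe]] := sections_basis K n d k.
set N := h0 _ _ _ in e he fe *.
pose q := Q ^+ 2.
have pe i : p * e i \is (2 * d).-homog.
  by have [kd hei] := he i; have := dhomogM hp hei; rewrite subnKC.
have hq : q \is (2 * (k - d)).-homog by rewrite mulnC; apply: dhomogMn.
have qe i : q * e i \is k.-homog.
  have [kd hei] := he i; have := dhomogM hq hei.
  by rewrite (_ : 2 * (k - d) + (2 * d - k) = k)%N //; lia.
have qee i j : q * (e i * e j) \is (2 * d).-homog.
  have [kd hej] := he j; have := dhomogM (qe i) hej.
  by rewrite subnKC // mulrA.
have [mm [mmE hpmm hqmm]] : exists mm : {mpoly {mpoly K[N]}[n.+1]},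
    [/\ forall t, at_param t mm = param_form e t,
      lift_param N p * mm \is (2 * d).-homog &
      lift_param N q * (mm * mm) \is (2 * d).-homog].
  exists (\sum_j ('X_j)%:MP * lift_param N (e j)); split=> [t||].
  - rewrite at_param_sum; apply: eq_bigr => j _.
    by rewrite at_paramM at_paramC mevalXU at_param_lift mul_mpolyC.
  - rewrite mulr_sumr; apply: rpred_sum => j _.
    by rewrite mulrCA -lift_paramM mul_mpolyC; apply: rpredZ; apply: lift_param_homog.
  rewrite [X in _ * X]mulr_suml mulr_sumr; apply: rpred_sum => i _.
  rewrite [X in _ * X]mulr_sumr mulr_sumr; apply: rpred_sum => j _.
  have -> : lift_param N q * (('X_i)%:MP * lift_param N (e i) * (('X_j)%:MP * lift_param N (e j))) =
      ('X_i * 'X_j)%:MP * lift_param N (q * (e i * e j)).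
    rewrite (lift_paramM N q (e i * e j)) (lift_paramM N (e i) (e j)) mpolyCM.
    move: (lift_param N q) (lift_param N (e i)) (lift_param N (e j)) => x1 x2 x3.
    by ring.
  by rewrite mul_mpolyC; apply: rpredZ; apply: lift_param_homog.
have [AA AE] : exists AA, forall t, at_param t AA = p + q * param_form e t.
  exists (lift_param N p + lift_param N q * mm) => t.
  by rewrite at_paramD at_paramM !at_param_lift mmE.
have [BB BE hBB] : exists2 BB, forall t, at_param t BB = family_member c p q e t
    & BB \is (2 * d).-homog.
  exists (lift_param N c - lift_param N p * mm - lift_param N p * mm
    - lift_param N q * (mm * mm)) => [t|].
    rewrite !(at_paramD, at_paramN) !at_paramM.
    rewrite !at_param_lift mmE /family_member.
    by rewrite scaler_nat mulr2n opprD addrA expr2.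
  by rewrite !rpredB // lift_param_homog.
have param0 : param_form e (fun=> 0) = 0.
  by rewrite /param_form big1 // => i _; rewrite scale0r.
have d2k : (2 * d <= k + k)%N by lia.
have [|s [s0 hs]] := good_pair_open uK es_homog hBB d2k (AA := AA) (y0 := fun=> 0).
  rewrite AE BE /family_member param0 !(mulr0, scaler0, expr0n, addr0, subr0).
  exact: gpc.
have hmember t : s.@[t] != 0 -> hypersurface (2 * d) (at_param t BB).
  move=> /hs/good_pair_neq0 B0; split=> //; exact: at_param_homog.
(* The parameters are the t with s(t) != 0, where (A_t, B_t) is a good pair; t = 0 is one of them
   and gives (p, c). *)
exists N, [::], [:: s], BB => T; split=> [t [_ [o]]|].
  rewrite inE => /eqP -> st; rewrite -at_paramE; split; first exact: hmember.
  have iI := in_idealP [:: P; Q]; have [_ ID IM] := iI.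
  have hqm : q * param_form e t \is k.-homog.
    rewrite /param_form mulr_sumr; apply: rpred_sum => j _.
    by rewrite -scalerAr; apply: rpredZ; apply: qe.
  apply: (contact_unique uK hn hd hdk P0 Q0 regPQ es_span w0 (A := at_param t AA)).
  - rewrite EW AE BE /family_member /q scaler_nat; ring.
  - exact: hW.
  - by rewrite AE rpredD.
  - rewrite AE; apply: ID => //; apply/in_ideal2; exists 0, (Q * param_form e t).
    by rewrite /q; ring.
  - by have [] := hmember t st.
  - exact: hs.
have reg := good_pair_regular hc gpc.
have c0 := good_pair_neq0 gpc.
apply: (family_dimension (q := q) uK hc pe _ s0).
  move=> b t E.
  (* [c] divides p m, hence m by regularity; but m has degree 2d - k < 2d, so m = 0 and then b =
     0. *)
  have pm : p * param_form e t = c * (- b%:MP).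
    by move/eqP: E; rewrite addrC addr_eq0 => /eqP ->; rewrite mulrN [c * _]mulrC mul_mpolyC.
  have [h Eh] := reg _ _ pm.
  have m0 : param_form e t = 0.
    have [kd|dk] := leqP k (2 * d); last first.
      rewrite /param_form big1 // => i _; have [] := he i.
      by rewrite leqNgt dk.
    have hm : param_form e t \is (2 * d - k).-homog.
      by apply: rpred_sum => i _; apply: rpredZ; have [] := he i.
    have [|//|[dk _]] := homog_dvd hc hm; first by exists h; rewrite Eh mulrC.
    by move: dk; rewrite leqNgt ltn_subrL k0 muln_gt0 hd.
  split; last exact: fe m0.
  move: E; rewrite m0 mulr0 addr0 => /eqP; rewrite scaler_eq0 (negPf c0) orbF => /eqP //.
move=> b t b0 st; exists t; last by exists b; rewrite // -at_paramE BE.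
split; first by move=> x; rewrite in_nil.
by exists s; rewrite ?mem_head.
Qed.

End Family.

(** * The complex numbers are uncountable *)

Section Uncountable.
Context (R : realType) (e : nat -> R).

(** Cantor's nested intervals: the outer third that is kept lies strictly on one side of [e m]. *)
Fixpoint nested (n : nat) : R * R :=
  if n is m.+1 then
    let: (a, b) := nested m in
    if e m < (a + b *+ 2) / 3 then ((a + b *+ 2) / 3, b) else (a, (a *+ 2 + b) / 3)
  else (0, 1).

Lemma nested_lt n : (nested n).1 < (nested n).2.
Proof.
elim: n => [|n] /=; first exact: ltr01.
by case: (nested n) => a b /= ab; case: ifP => _ /=; lra.
Qed.

Lemma nestedS n : (nested n).1 <= (nested n.+1).1 /\ (nested n.+1).2 <= (nested n).2.
Proof.
by have := nested_lt n; rewrite /=; case: (nested n) => a b /= ab; case: ifP => _ /=; lra.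
Qed.

Lemma nested_mono n m : (nested n).1 <= (nested (m + n)).1 /\ (nested (m + n)).2 <= (nested n).2.
Proof.
elim: m => [|m [IH1 IH2]]; first by [].
have [h1 h2] := nestedS (m + n).
by split; [apply: le_trans h1|apply: le_trans IH2].
Qed.

Lemma nested_le n m : (nested n).1 <= (nested m).2.
Proof.
have [h _] := nested_mono n m; have [_ h'] := nested_mono m n.
by apply: (le_trans h); apply: le_trans h'; rewrite addnC ltW // nested_lt.
Qed.

Lemma nested_avoid n x : (nested n.+1).1 <= x <= (nested n.+1).2 -> e n <> x.
Proof.
have := nested_lt n; rewrite /=; case: (nested n) => a b /= ab.
by case: ltP => h /= /andP[h1 h2] E; move: h h1 h2; rewrite E; lra.
Qed.

Lemma avoid_sequence : exists x, forall i, e i <> x.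
Proof.
pose E : classical_sets.set R := fun x => exists n, x = (nested n).1.
have E0 : E (nested 0).1 by exists 0%N.
have ubE m : classical_sets.ubound E (nested m).2 by move=> x [n ->]; apply: nested_le.
exists (sup E) => n; apply: nested_avoid; apply/andP; split.
  by apply: ub_le_sup; [exists (nested 0).2|exists n.+1].
by apply: ge_sup; [exists (nested 0).1|apply: ubE].
Qed.

End Uncountable.

Lemma complex_uncountable (R : realType) : uncountable R[i]%C.
Proof.
move=> e; have [x hx] := avoid_sequence (fun n => complex.Re (e n)).
by exists (x +i* 0)%C => i E; apply: (hx i); rewrite E.
Qed.

(** * General hypersurfaces *)

(** The pseudo-inverse is a section on the image but may return another preimage of y0 Phi. A map of
    rank one with values in the kernel of [Phi] corrects this. *)
Lemma linear_section (K : fieldType) (M N : nat) (Phi : 'M[K]_(M, N)) (y0 : 'rV[K]_M) :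
  y0 *m Phi != 0 -> exists psi : 'M[K]_(N, M),
    (forall y : 'rV[K]_M, y *m Phi *m psi *m Phi = y *m Phi) /\ y0 *m Phi *m psi = y0.
Proof.
move Ew: (y0 *m Phi) => w /rV0Pn [j wj].
pose l : 'M[K]_(N, 1) := (w 0 j)^-1 *: delta_mx j 0.
have wl : w *m l = 1%:M.
  apply/matrixP => i i'; rewrite !ord1 mxE (bigD1 j) //= big1 => [|j' j'j].
    by rewrite !mxE !eqxx mulr1 addr0 divff.
  by rewrite !mxE (negPf j'j) !mulr0.
have sub (y : 'rV[K]_M) : y *m Phi *m pinvmx Phi *m Phi = y *m Phi.
  by rewrite mulmxKpV ?submxMl.
exists (pinvmx Phi + l *m (y0 - w *m pinvmx Phi)); split=> [y|].
  have z : (y0 - w *m pinvmx Phi) *m Phi = 0 by rewrite mulmxBl -Ew sub subrr.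
  by rewrite mulmxDr mulmxDl sub -[X in _ + X]mulmxA -[l *m _ *m _]mulmxA z !mulmx0 addr0.
by rewrite mulmxDr mulmxA wl mul1mx addrC subrK.
Qed.

Lemma combination_family (K : fieldType) (M N a k : nat) (es : 'I_a -> {mpoly K[N]})
    (f : 'I_a -> 'I_M) : (forall i, es i \is k.-homog) ->
  exists2 F : {mpoly {mpoly K[M]}[N]}, F \is k.-homog &
    forall y, at_param y F = combination es (fun i => y (f i)).
Proof.
move=> hes; exists (\sum_i ('X_(f i))%:MP * lift_param M (es i)) => [|y].
  apply: rpred_sum => i _; rewrite mul_mpolyC; apply: rpredZ.
  exact: lift_param_homog.
rewrite at_param_sum; apply: eq_bigr => i _.
by rewrite at_paramM at_paramC mevalXU at_param_lift mul_mpolyC.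
Qed.

(** The density argument: on a line where [s] is not identically zero (it is nonzero at t = 1), a
    polynomial vanishing wherever [s] does not is zero, in particular at t = 0. *)
Lemma vanish_along_line (K : closedFieldType) (M N : nat) (s : {mpoly K[M]}) (g : {mpoly K[N]})
    (y v : 'I_M -> K) (x u : 'I_N -> K) :
  s.@[fun i => y i + v i] != 0 ->
  (forall t, s.@[fun i => y i + t * v i] != 0 -> g.@[fun i => x i + t * u i] = 0) ->
  g.@[x] = 0.
Proof.
move=> s1 h; have p0 : on_line y v s != 0.
  apply: contraNneq s1 => p0; have := horner_on_line y v s 1; rewrite p0 horner0 => ->.
  by apply/eqP/meval_eq => i; rewrite mul1r.
have q0 : on_line x u g = 0.
  apply/eqP; apply/negP => /negP q0; have := mulf_neq0 p0 q0 => /closed_nonrootP [t].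
  rewrite rootE hornerM !horner_on_line mulf_eq0 negb_or => /andP[st].
  by rewrite h // eqxx.
have := horner_on_line x u g 0; rewrite q0 horner0 => ->.
by apply: meval_eq => i; rewrite mul0r addr0.
Qed.

Section General.
Context (K : numClosedFieldType) (n k d : nat).
Hypothesis uK : uncountable K.
Hypotheses (hn : (2 <= n)%N) (hd : (0 < d)%N) (hdk : (d <= k)%N).
Context (P Q : {mpoly K[n.+1]}).
Hypotheses (P0 : P != 0) (Q0 : Q != 0) (hP : P \is k.-homog) (hQ : Q \is (k - d).-homog).

(* A non-zero-divisor modulo (P, Q) does not vanish identically on any component of Z. *)
Lemma ordinary_dense (r : K) b c (delta : {mpoly K[n.+1]}) :
  delta = (4%:R * r) *: c - b ^+ 2 ->
  (forall y, in_ideal [:: P; Q] (delta * y) -> in_ideal [:: P; Q] y) ->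
  ordinary_double_along P Q (r *: P ^+ 2 + b * (P * Q) + c * Q ^+ 2).
Proof.
move=> Ed reg; set W := _ + _ + _; split.
  move=> z _ F; rewrite inE => /eqP ->; apply: in_stalk_ideal; apply/in_ideal3.
  by exists r%:MP, b, c; rewrite mul_mpolyC.
move=> H hH z [i zi] Pz Qz; have [_ _ IM] := in_idealP [:: P; Q].
have eval0 x f : P.@[x] = 0 -> Q.@[x] = 0 -> in_ideal [:: P; Q] f -> f.@[x] = 0.
  by move=> Px Qx /in_ideal2 [u [v ->]]; rewrite mevalD !mevalM Px Qx !mulr0 addr0.
(* On P = Q = 0 the product vanishes: X_i takes care of the origin, and where [delta], minus the
   discriminant, is nonzero the point is ordinary, so [H] is 0. The power of [delta] is then
   cancelled modulo (P, Q). *)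
have [x hx|m] := nullstellensatz uK (in_idealP [:: P; Q]) (w := 'X_i * H * delta).
  have Px : P.@[x] = 0 by apply: hx; apply/in_ideal2; exists 1, 0; rewrite mul1r mul0r addr0.
  have Qx : Q.@[x] = 0 by apply: hx; apply/in_ideal2; exists 0, 1; rewrite mul1r mul0r add0r.
  rewrite !mevalM mevalXU; have [->|xi] := eqVneq (x i) 0; first by rewrite !mul0r.
  have [->|dx] := eqVneq delta.@[x] 0; first by rewrite mulr0.
  rewrite (hH x) ?mulr0 ?mul0r //; first by exists i.
  exists 1, r%:MP, b, c; split; first by rewrite meval1 oner_neq0.
    by rewrite mul1r /W mul_mpolyC.
  move: dx; rewrite Ed mevalB mevalZ rmorphXn mevalC /= -oppr_eq0 opprB.
  by congr (_ - _ != 0).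
have power j y : in_ideal [:: P; Q] (delta ^+ j * y) -> in_ideal [:: P; Q] y.
  elim: j => [|j IH]; first by rewrite mul1r.
  by rewrite exprS -mulrA => /reg.
rewrite exprMn mulrC => /power h.
have := eval0 z _ Pz Qz h; rewrite rmorphXn /= mevalM mevalXU => /eqP.
by rewrite expf_eq0 mulf_eq0 (negPf zi) /= => /andP[_ /eqP].
Qed.

Theorem contact_families (hZ : smooth_complete_intersection k (k - d) P Q) :
  for_general (2 * k)
    (fun W => hypersurface (2 * k) W /\ ordinary_double_along P Q W)
    (fun W =>
       exists_family (2 * d) (h0 K n ((2 * d)%:Z - k%:Z))
         (fun B =>
            exists A : {mpoly K[n.+1]},
              let contact A' :=
                [/\ hypersurface k A', subscheme [:: P; Q] [:: A']
                  & cuts_contact_locus W B A'] in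
              contact A /\ forall A', contact A' -> same_hypersurface A A')).
Proof.
have k0 : (0 < k)%N by apply: leq_trans hd hdk.
have dk : (2 * d <= k + k)%N by lia.
have degPQ : (d + (k + (k - d)) = 2 * k)%N by lia.
have degQ2 : (2 * d + 2 * (k - d) = 2 * k)%N by lia.
have [p0 [x0 [Pp cop]]] := smooth_line uK (ltnW hn) k0 hZ.
(* The line gives the regularity of [Q] modulo [P]; the condition is symmetric for P != 0 in a
   domain. *)
have regPQ : regular_pair P Q.
  have regQP : regular_pair Q P.
    by apply: (regular_on_line (msize_homog hP) _ cop); rewrite pihomog_dE.
  move=> f g E; have [h Eh] := regQP g f (esym E).
  by exists h; apply: (mulfI P0); rewrite E Eh; ring.
have [zs [hzs regZ]] := test_points uK hn hP Pp cop.
have [a [es [es_homog es_free es_ideal es_span]]] := ideal_forms_basis hP hQ (leq_subr d k).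
have [c0 [hc0 c0zs gc0]] := exists_good_pair uK hn hd hdk P0 Q0 hP hQ es_homog es_free es_ideal hzs regZ.
have basis D : exists N (e : 'I_N -> {mpoly K[n.+1]}), (forall i, e i \is D.-homog) /\
    forall F, F \is D.-homog -> exists u, F = combination e u.
  by have [e [he _ hs]] := forms_basis K n D; exists _, e.
have [N1 [e1 [he1 span1]]] := basis d; have [N2 [e2 [he2 span2]]] := basis (2 * d)%N.
(* Coordinates on the triples (a, b, c): a constant, a form of degree d and one of degree 2d. *)
pose M := (1 + (N1 + N2))%N.
pose ia : 'I_M := lshift _ ord0.
pose ib (i : 'I_N1) : 'I_M := rshift 1 (lshift N2 i).
pose ic (i : 'I_N2) : 'I_M := rshift 1 (rshift N1 i).
have sa : split (lshift (N1 + N2) (ord0 : 'I_1)) = inl ord0 by apply: (unsplitK (inl _)).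
have sr (j : 'I_(N1 + N2)) : split (rshift 1 j) = inr j by apply: (unsplitK (inr _)).
have sb (i : 'I_N1) : split (lshift N2 i) = inl i by apply: (unsplitK (inl _)).
have sc (i : 'I_N2) : split (rshift N1 i) = inr i by apply: (unsplitK (inr _)).
pose fb (y : 'I_M -> K) := combination e1 (fun i => y (ib i)).
pose fc (y : 'I_M -> K) := combination e2 (fun i => y (ic i)).
pose w (j : 'I_M) : {mpoly K[n.+1]} := match split j with
  | inl _ => P ^+ 2
  | inr j' => match split j' with inl i => e1 i * (P * Q) | inr i => e2 i * Q ^+ 2 end end.
have wE y : combination w y = y ia *: P ^+ 2 + fb y * (P * Q) + fc y * Q ^+ 2.
  rewrite /combination /M big_split_ord big_ord1 big_split_ord /= addrA /w; congr (_ + _ + _).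
  - by rewrite sa.
  - rewrite mulr_suml; apply: eq_bigr => i _.
    by rewrite sr sb scalerAl.
  rewrite mulr_suml; apply: eq_bigr => i _.
  by rewrite sr sc scalerAl.
have hfb y : fb y \is d.-homog by apply: combination_homog.
have hfc y : fc y \is (2 * d).-homog by apply: combination_homog.
have hP2 : P ^+ 2 \is (2 * k).-homog by rewrite mulnC; apply: dhomogMn.
have hPQ : P * Q \is (k + (k - d)).-homog by apply: dhomogM.
have hQ2 : Q ^+ 2 \is (2 * (k - d)).-homog by rewrite mulnC; apply: dhomogMn.
have hW y : combination w y \is (2 * k).-homog.
  rewrite wE; apply: rpredD; first apply: rpredD.
  - exact: rpredZ.
  - by have := dhomogM (hfb y) hPQ; rewrite degPQ.
  - by have := dhomogM (hfc y) hQ2; rewrite degQ2.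
pose fp (y : 'I_M -> K) := (2%:R * y ia) *: P + fb y * Q.
pose fd (y : 'I_M -> K) := (4%:R * y ia) *: fc y - fb y ^+ 2.
have EW y : (4%:R * y ia) *: combination w y = fp y ^+ 2 + Q ^+ 2 * fd y.
  by rewrite wE /fp /fd -!mul_mpolyC !mpolyCM !mpolyC_nat; ring.
have [BF hBF BFE] := combination_family (K := K) ib he1.
have [CF hCF CFE] := combination_family (K := K) ic he2.
have [AA AE] : exists AA, forall y, at_param y AA = fp y.
  exists ((2%:R *: 'X_ia)%:MP * lift_param M P + BF * lift_param M Q) => y.
  by rewrite at_paramD !at_paramM !at_param_lift at_paramC mevalZ mevalXU BFE mul_mpolyC.
have [DD hDD DE] : exists2 DD, DD \is (2 * d).-homog & forall y, at_param y DD = fd y.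
  exists ((4%:R *: 'X_ia)%:MP * CF - BF * BF) => [|y].
    apply: rpredB; first by rewrite mul_mpolyC; apply: rpredZ.
    by rewrite mulSn mul1n; apply: dhomogM.
  by rewrite at_paramD at_paramN !at_paramM at_paramC mevalZ mevalXU BFE CFE mul_mpolyC.
(* The triple (1/2, 0, c0/2), for which completing the square gives exactly the good pair (P,
   c0). *)
have [y0 [y0a fp0 fd0]] : exists y0, [/\ y0 ia != 0, fp y0 = P & fd y0 = c0].
  have [v Ev] := span2 ((2%:R)^-1 *: c0) (rpredZ _ hc0).
  pose y0 (j : 'I_M) := match split j with inl _ => 2%:R^-1
    | inr j' => if split j' is inr i then v i else 0 end.
  have y0a : y0 ia = 2%:R^-1 by rewrite /y0 sa.
  have y0b : fb y0 = 0.
    rewrite /fb /combination big1 // => i _.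
    by rewrite /y0 sr sb scale0r.
  have y0c : fc y0 = 2%:R^-1 *: c0.
    rewrite Ev; apply: eq_bigr => i _.
    by rewrite /y0 sr sc.
  have two : 2%:R != 0 :> K by rewrite pnatr_eq0.
  exists y0; rewrite /fp /fd y0a y0b y0c mul0r addr0 expr0n subr0 divff // scale1r scalerA; split=> //.
    by rewrite invr_eq0.
  rewrite -[4%:R]/((2 * 2)%:R) natrM mulfK // divff ?scale1r //.
have [|s1 [s10 hs1]] := good_pair_open uK es_homog hDD dk (AA := AA) (y0 := y0).
  by rewrite AE DE fp0 fd0.
(* Nonvanishing at the test points makes the discriminant regular modulo (P, Q), as [ordinary_dense]
   requires. *)
pose s2 := \prod_(z <- zs) DD.@[fun i => (z i)%:MP].
have s2E y : s2.@[y] != 0 <-> {in zs, forall z : {ffun 'I_n.+1 -> K}, (fd y).@[z] != 0}.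
  rewrite /s2 rmorph_prod prodf_seq_neq0 -DE; split.
    by move/allP => h z /h /=; rewrite meval_at_param.
  by move=> h; apply/allP => z /h /=; rewrite meval_at_param.
pose s := 'X_ia * (s1 * s2).
have s0 : s.@[y0] != 0.
  by rewrite !mevalM mevalXU !mulf_neq0 //; apply/s2E; rewrite fd0.
have hs y : s.@[y] != 0 -> [/\ 4%:R * y ia != 0, good_pair es (fp y) (fd y) &
    {in zs, forall z : {ffun 'I_n.+1 -> K}, (fd y).@[z] != 0}].
  rewrite !mevalM mevalXU !mulf_eq0 !negb_or => /and3P[ya s1y /s2E s2y].
  split; first by rewrite ya pnatr_eq0.
    by rewrite -AE -DE; apply: hs1.
  exact: s2y.
have hfp y : fp y \is k.-homog.
  apply: rpredD; first exact: rpredZ.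
  by have := dhomogM (hfb y) hQ; rewrite subnKC.
have hfd y : fd y \is (2 * d).-homog by rewrite -DE; apply: at_param_homog.
have ifp y : in_ideal [:: P; Q] (fp y).
  by apply/in_ideal2; exists (2%:R * y ia)%:MP, (fb y); rewrite mul_mpolyC.
have WX y : s.@[y] != 0 -> hypersurface (2 * k) (combination w y) /\
    ordinary_double_along P Q (combination w y).
  move=> /hs [ya gy zy]; split; last by rewrite wE; apply: ordinary_dense => // x; apply: regZ.
  split; last exact: hW.
  (* If W were 0, then [fp y ^+ 2] would be a multiple of [fd y]; regularity, used twice, would make
     the form [fd y] of positive degree a unit. *)
  apply/eqP => W0; have := EW y; rewrite W0 scaler0 => /esym/eqP; rewrite addr_eq0 => /eqP E.
  have reg := good_pair_regular (hfd y) gy.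
  have [h Eh] : exists h, fp y = fd y * h by apply: (reg _ (- Q ^+ 2)); rewrite -expr2 E; ring.
  have [h' Eh'] : exists h', 1 = fd y * h' by apply: (reg _ h); rewrite mulr1.
  exact: (one_notin_form_ideal hd (hfd y) Eh').
have WC y : s.@[y] != 0 -> hypersurface (2 * k) (combination w y) -> exists_family (2 * d)
    (h0 K n ((2 * d)%:Z - k%:Z)) (fun B => exists A : {mpoly K[n.+1]}, let contact A' :=
      [/\ hypersurface k A', subscheme [:: P; Q] [:: A']
        & cuts_contact_locus (combination w y) B A'] in
      contact A /\ forall A', contact A' -> same_hypersurface A A').
  move=> /hs [ya gy _] hyW.
  exact: (family_exists uK hn hd hdk P0 Q0 hP hQ regPQ es_homog es_span ya (EW y) hyW
    (hfp y) (ifp y) (hfd y) gy).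
have Wspan F : hypersurface (2 * k) F /\ ordinary_double_along P Q F -> exists y, F = combination w y.
  move=> [[_ hF] [hdouble _]].
  have [|||b1 [b2 [b3 [hb1 hb2 hb3 E]]]] := homog_in_ideal3 hP2 hPQ hQ2 hF (leqnn _) _ _ _.
  - by rewrite -degPQ leq_addl.
  - by rewrite -degQ2 leq_addl.
  - apply: (stalks_in_ideal_square uK hn P0 Q0 regPQ) => z hz.
    by apply: hdouble => //; rewrite mem_head.
  rewrite subnn in hb1; rewrite -degPQ addnK in hb2; rewrite -degQ2 addnK in hb3.
  have [u2 E2] := span1 _ hb2; have [u3 E3] := span2 _ hb3.
  exists (fun j => match split j with inl _ => b1@_0
    | inr j' => match split j' with inl i => u2 i | inr i => u3 i end end).
  rewrite wE sa E {1}(dhomog0_const hb1) mul_mpolyC; congr (_ + _ * _ + _ * _).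
    by rewrite E2; apply: eq_bigr => i _; rewrite sr sb.
  by rewrite E3; apply: eq_bigr => i _; rewrite sr sc.
pose wm : 'M[K]_(M, ncoef n (2 * k)) := \matrix_i coef_row (2 * k) (w i).
have coefW (y : 'rV[K]_M) : coef_row (2 * k) (combination w (y 0)) = y *m wm.
  rewrite mulmx_sum_row coef_row_sum; apply: eq_bigr => i _.
  by rewrite coef_rowZ rowK.
have coef_row_inj F G : F \is (2 * k).-homog -> G \is (2 * k).-homog ->
    coef_row (2 * k) F = coef_row (2 * k) G -> F = G.
  move=> hF hG E; apply/eqP; rewrite -subr_eq0; apply/eqP.
  apply: (coef_row_eq0 (rpredB hF hG)); rewrite coef_rowD -scaleN1r coef_rowZ E scaleN1r.
  by rewrite subrr.
pose r0 : 'rV[K]_M := \row_j y0 j.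
have r0E : combination w (r0 0) = combination w y0 by apply: eq_bigr => i _; rewrite mxE.
(* W does not determine its triple, so an open condition on triples is carried over to the
   coefficients of W through a linear section. Taking W_y0 back to [y0] keeps [s] nonzero after
   composition. *)
have [psi [psi_section psi0]] : exists psi : 'M[K]_(ncoef n (2 * k), M),
    (forall y : 'rV[K]_M, y *m wm *m psi *m wm = y *m wm) /\ r0 *m wm *m psi = r0.
  apply: linear_section; rewrite -coefW r0E; apply/eqP => E.
  have [[W0 _] _] := WX y0 s0.
  by move: W0; rewrite (coef_row_eq0 (hW y0) E) eqxx.
pose S := s \mPo [tuple \sum_i psi i j *: 'X_i | j < M].
have SE F : S.@[coefs (2 * k) F] = s.@[(coef_row (2 * k) F *m psi) 0].
  rewrite comp_mpoly_meval; apply: meval_eq => j; rewrite tnth_mktuple raddf_sum mxE.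
  by apply: eq_bigr => i _ /=; rewrite mevalZ mevalXU [coef_row _ _ _ _]mxE mulrC.
have sectionW F : hypersurface (2 * k) F /\ ordinary_double_along P Q F ->
    F = combination w ((coef_row (2 * k) F *m psi) 0).
  move=> XF; have [y Ey] := Wspan F XF; have [[_ hF] _] := XF.
  apply: coef_row_inj => //; rewrite coefW.
  have -> : coef_row (2 * k) F = (\row_j y j) *m wm.
    by rewrite -coefW Ey; congr coef_row; apply: eq_bigr => i _; rewrite mxE.
  by rewrite psi_section.
exists [:: S] => U; split=> [g hg F XF|F [XF [f]]]; last first.
  rewrite inE => /eqP ->; rewrite SE => sF; have [hF _] := XF.
  by move: hF; rewrite (sectionW F XF); apply: WC.
have EF := sectionW F XF; set xF := coef_row (2 * k) F in EF.
(* The line from the chosen triple of F, at t = 0, to [y0], at t = 1. Along it [psi] recovers the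
   triple from W, so the parameters with s != 0 give members of [U]. *)
pose yt t : 'rV[K]_M := xF *m psi + t *: (r0 - xF *m psi).
have ytE t : yt t *m wm = xF + t *: (r0 *m wm - xF).
  by rewrite mulmxDl -scalemxAl mulmxBl -coefW -EF.
have coefE G : g.@[coefs (2 * k) G] = g.@[coef_row (2 * k) G 0].
  by apply: meval_eq => i; rewrite mxE.
rewrite coefE; apply: (vanish_along_line (s := s) (y := (xF *m psi) 0)
  (v := (r0 - xF *m psi) 0) (u := (r0 *m wm - xF) 0)) => [|t].
  rewrite (_ : _.@[_] = s.@[y0]) //; apply: meval_eq => j.
  have -> : y0 j = (xF *m psi + (r0 - xF *m psi)) 0 j by rewrite addrC subrK mxE.
  by rewrite [RHS]mxE.
have -> : s.@[fun i => (xF *m psi) 0 i + t * (r0 - xF *m psi) 0 i] = s.@[yt t 0].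
  by apply: meval_eq => j; rewrite !mxE.
have -> : g.@[fun i => xF 0 i + t * (r0 *m wm - xF) 0 i] =
    g.@[coefs (2 * k) (combination w (yt t 0))].
  by rewrite coefE coefW ytE; apply: meval_eq => j; rewrite !mxE.
move=> st; apply: hg; split; first exact: WX.
exists S; first by rewrite inE.
rewrite SE coefW ytE mulmxDl -scalemxAl mulmxBl psi0.
exact: st.
Qed.

End General.

Local Open Scope complex_scope.

Theorem mainTheorem2 (R : realType) (n k d : nat)
    (hn : (2 <= n)%N) (hd : (0 < d)%N) (hdk : (d <= k)%N)
    (P Q : {mpoly R[i][n.+1]})
    (hZ : smooth_complete_intersection k (k - d) P Q) :
  for_general (2 * k)
    (fun W => hypersurface (2 * k) W /\ ordinary_double_along P Q W)
    (fun W =>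
       exists_family (2 * d) (h0 R[i] n ((2 * d)%:Z - k%:Z))
         (fun B =>
            exists A : {mpoly R[i][n.+1]},
              let contact A' :=
                [/\ hypersurface k A', subscheme [:: P; Q] [:: A']
                  & cuts_contact_locus W B A'] in
              contact A /\ forall A', contact A' -> same_hypersurface A A')).
Proof.
have [[P0 hP] [Q0 hQ] _] := hZ.
exact: (contact_families (@complex_uncountable R) hn hd hdk P0 Q0 hP hQ hZ).
Qed.
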